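(* Let $H$ be a separable Hilbert space and $G=(g_n)_{n=1}^\infty$ a Riesz basis for $H$. For $k\in\mathbb N_0$ let $\mu_k$ be weights with $1=\mu_0(x)\le\mu_1(x)\le\mu_2(x)\le\dots$ for every $x\in\mathbb R$, let $\Theta_k=\ell^2_{\mu_k}$, $\Theta_F=\bigcap_{k\in\mathbb N_0}\Theta_k$, $X_k=H_G^{\Theta_k}$, $X_F=\bigcap_{k\in\mathbb N_0}X_k$. Let $E=(e_n)_{n=1}^\infty$ be a sequence with elements in $X_F$ which is a frame for $H$. Assume that either (A) for each $k\in\mathbb N_0$, $\mu_k$ is a $\beta_k$-sub-exponential weight, and $E$ is either $\beta$-sub-exponentially localized with respect to $G$ for some $\beta\in(0,1)$ with $\beta>\beta_k$ for all $k\in\mathbb N_0$, or exponentially localized with respect to $G$; or (B) for each $k\in\mathbb N_0$, $\mu_k$ is a $k$-moderate weight, and $E$ is $s$-localized with respect to $G$ for every $s\in\mathbb N$. Let $(\widetilde{e_n})_{n=1}^\infty$ be the canonical dual frame of $E$. Then $\widetilde{e_n}\in X_F$ for every $n\in\mathbb N$ and the following statements hold. (i) The analysis operator $U_E:f\mapsto(\langle f,e_n\rangle)_{n=1}^\infty$ is $F$-bounded from $X_F$ into $\Theta_F$, the synthesis operator $T_E:(c_n)\mapsto\sum_nc_ne_n$ is $F$-bounded from $\Theta_F$ into $X_F$, and the frame operator $S_E=T_EU_E$ is $F$-bounded and bijective from $X_F$ onto $X_F$, with unconditional convergence of the series in $S_Ef=\sum_{n=1}^\infty\langle f,e_n\rangle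 e_n$. (ii) For every $f\in X_F$, $f=\sum_{n=1}^\infty\langle f,\widetilde{e_n}\rangle e_n=\sum_{n=1}^\infty\langle f,e_n\rangle\widetilde{e_n}$ with convergence in $X_F$, and $(\langle f,\widetilde{e_n}\rangle)_{n=1}^\infty\in\Theta_F$, $(\langle f,e_n\rangle)_{n=1}^\infty\in\Theta_F$. (iii) For a sequence $(x_n)_{n=1}^\infty$ in $H$ let $\mathcal P_{(x_n)}$ be the property: for $f\in H$, $f\in X_F$ if and only if $(\langle f,x_n\rangle)_{n=1}^\infty\in\Theta_F$. If $\mathcal P_{(g_n)}$ holds, then $\mathcal P_{(e_n)}$ and $\mathcal P_{(\widetilde{e_n})}$ also hold. (iv) Both $(e_n)_{n=1}^\infty$ and $(\widetilde{e_n})_{n=1}^\infty$ form Fréchet frames for $X_F$ with respect to $\Theta_F$. (v) For every $g\in X_F^*$, $g=\sum_{n=1}^\infty g(e_n)\,\widetilde{e_n}=\sum_{n=1}^\infty g(\widetilde{e_n})\,e_n$ with convergence in $X_F^*$, and $(g(e_n))_{n=1}^\infty\in\Theta_F^*$, $(g(\widetilde{e_n}))_{n=1}^\infty\in\Theta_F^*$. (vi) If $(a_n)_{n=1}^\infty\in\Theta_F^*$, then $\sum_{n=1}^\infty a_ne_n$ (resp. $\sum_{n=1}^\infty a_n\widetilde{e_n}$) converges in $X_F^*$, i.e. the mapping $f\mapsto\sum_{n=1}^\infty\langle f,e_n\rangle a_n$ (resp. $f\mapsto\sum_{n=1}^\infty\langle f,\widetilde{e_n}\rangle a_n$) determines a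 continuous linear functional on $X_F$.
   Context: $\mathbb N=\{1,2,\dots\}$, $\mathbb N_0=\mathbb N\cup\{0\}$. A frame for $H$ is a sequence $(e_n)$ in $H$ with $A\|f\|^2\le\sum_n|\langle f,e_n\rangle|^2\le B\|f\|^2$ for all $f\in H$ and some $A,B>0$; its canonical dual is $\widetilde{e_n}=S^{-1}e_n$, where $Sf=\sum_n\langle f,e_n\rangle e_n$ on $H$. A Riesz basis is the image of an orthonormal basis under a bounded bijective operator on $H$; $(\widetilde{g_n})$ denotes its canonical dual. Localization of $E$ with respect to the Riesz basis $G$: with $D_{m,n}=\max\{|\langle e_m,g_n\rangle|,|\langle e_m,\widetilde{g_n}\rangle|\}$, $E$ is $s$-localized ($s>0$) if there is $C>0$ with $D_{m,n}\le C(1+|m-n|)^{-s}$ for all $m,n\in\mathbb N$; exponentially localized if there are $\gamma,C>0$ with $D_{m,n}\le Ce^{-\gamma|m-n|}$ for all $m,n$; $\beta$-sub-exponentially localized ($\beta\in(0,1)$) if there are $\gamma,C>0$ with $D_{m,n}\le Ce^{-\gamma|m-n|^\beta}$ for all $m,n$. Weights: a positive continuous function $\mu$ on $\mathbb R$ is $k$-moderate ($k\ge0$) if there is $C>0$ with $\mu(t+x)\le C(1+|t|)^k\mu(x)$ for all $t,x\in\mathbb R$; it is $\beta$-sub-exponential ($\beta\in(0,1)$) if there are $C,\gamma>0$ with $\mu(t+x)\le Ce^{\gamma|t|^\beta}\mu(x)$ for all $t,x\in\mathbb R$. $\ell^2_\mu$ is the space of complex sequences $(a_n)_{n=1}^\infty$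 with norm $(\sum_n|a_n|^2\mu(n)^2)^{1/2}<\infty$. For $\Theta=\ell^2_\mu$, $H_G^{\Theta}$ is the Banach space of all $f\in H$ with $(\langle f,\widetilde{g_n}\rangle)_{n=1}^\infty\in\Theta$, normed by $\|f\|=\|(\langle f,\widetilde{g_n}\rangle)_n\|_\Theta$. $X_F$ and $\Theta_F$ are Fréchet spaces with the topologies given by the norms of $X_k$, respectively $\Theta_k$, $k\in\mathbb N_0$. A linear operator between two such spaces $Y_F=\bigcap_kY_k$ and $Z_F=\bigcap_kZ_k$ is $F$-bounded if for every $k\in\mathbb N_0$ there is $C_k>0$ with $\|Ty\|_{Z_k}\le C_k\|y\|_{Y_k}$ for all $y\in Y_F$. A sequence $(\phi_n)_{n=1}^\infty$ in $X_F^*$ is a Fréchet frame for $X_F$ with respect to $\Theta_F$ if: $(\phi_n(f))_n\in\Theta_F$ for all $f\in X_F$; there are constants $0<A_k\le B_k<\infty$ with $A_k\|f\|_{X_k}\le\|(\phi_n(f))_n\|_{\Theta_k}\le B_k\|f\|_{X_k}$ for all $f\in X_F$, $k\in\mathbb N_0$; and there is an $F$-bounded operator $V:\Theta_F\to X_F$ with $V(\phi_n(f))_{n=1}^\infty=f$ for all $f\in X_F$. When regarded as an element of $X_F^*$, a vector $x\in H$ denotes the functional $f\mapsto\langle f,x\rangle$. Series expansions in $X_F^*$ are understood through their action on elements: e.g. $g=\sum_ng(e_n)\widetilde{e_n}$ means $g(f)=\sum_n\langle f,\widetilde{e_n}\rangle g(e_n)$ for every $f\in X_F$. $\Theta_F^*$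 is identified with the sequence space $\{(U\delta_n)_{n=1}^\infty: U \text{ a continuous linear functional on }\Theta_F\}$, where $\delta_n$ is the $n$-th canonical vector. *)

(* Defs.v *)
From HB Require Import structures.
From mathcomp Require Import all_boot all_order all_algebra.
From mathcomp Require Import complex.
From mathcomp Require Import all_classical all_reals all_analysis.

Set Implicit Arguments.
Unset Strict Implicit.
Unset Printing Implicit Defensive.

Import Order.TTheory GRing.Theory Num.Theory.
Import numFieldNormedType.Exports.

Local Open Scope classical_set_scope.
Local Open Scope ring_scope.

(* Sequences are indexed by [nat], the term of index [n] standing for the
   (n+1)-st term of a sequence indexed by {1, 2, ...}. Only the weights of
   [ell2_sum] see the shift; |m - n| is not affected by it. *)

Notation cmod := ComplexField.Normc.normc.

Section Hilbert.
Variables (R : realType) (H : completeNormedModType R[i]).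
(* Linear in the first argument, conjugate-linear in the second. *)
Variable ip : {dot H for Num.conj}.

Definition hilbert_norm : Prop := forall x : H, `|x| ^+ 2 = ip x x.

Definition hnorm (x : H) : R := complex.Re `|x|.

Definition separable : Prop := exists D : set H, countable D /\ dense D.

Definition frame (e : nat -> H) : Prop :=
  exists A B : R, [/\ 0 < A, 0 < B & forall f : H,
    ((A * hnorm f ^+ 2)%:E <= \sum_(n <oo) (cmod (ip f (e n)) ^+ 2)%:E)%E /\
    (\sum_(n <oo) (cmod (ip f (e n)) ^+ 2)%:E <= (B * hnorm f ^+ 2)%:E)%E].

Definition analysis (e : nat -> H) (f : H) : nat -> R[i] := fun n => ip f (e n).

Definition synthesis (e : nat -> H) (c : nat -> R[i]) : H :=
  limn (series (fun n => c n *: e n)).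

Definition frame_op (e : nat -> H) (f : H) : H := synthesis e (analysis e f).

Definition canonical_dual (e : nat -> H) (n : nat) : H :=
  pinv setT (frame_op e) (e n).

Definition orthonormal_basis (u : nat -> H) : Prop :=
  (forall m n, ip (u m) (u n) = (m == n)%:R) /\
  (forall f : H, series (fun n => ip f (u n) *: u n) @ \oo --> f).

Definition riesz_basis (g : nat -> H) : Prop :=
  exists (u : nat -> H) (A : {linear H -> H}),
    [/\ orthonormal_basis u,
        exists C : R, forall x : H, hnorm (A x) <= C * hnorm x,
        bijective A & forall n, g n = A (u n)].

Section Localization.
Variables e g : nat -> H.

Definition loc_coef (m n : nat) : R :=
  Num.max (cmod (ip (e m) (g n))) (cmod (ip (e m) (canonical_dual g n))).

Definition idist (m n : nat) : R := `|m%:R - n%:R|.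

Definition poly_localized (s : R) : Prop :=
  exists C : R, 0 < C /\
    forall m n, loc_coef m n <= C * (1 + idist m n) `^ (- s).

Definition exp_localized : Prop :=
  exists gamma C : R, [/\ 0 < gamma, 0 < C &
    forall m n, loc_coef m n <= C * expR (- (gamma * idist m n))].

Definition subexp_localized (beta : R) : Prop :=
  exists gamma C : R, [/\ 0 < gamma, 0 < C &
    forall m n, loc_coef m n <= C * expR (- (gamma * idist m n `^ beta))].

End Localization.

End Hilbert.

Section Weights.
Variable R : realType.

Definition weight (mu : R -> R) : Prop :=
  continuous mu /\ forall x, 0 < mu x.

Definition moderate (k : R) (mu : R -> R) : Prop :=
  exists C : R, 0 < C /\
    forall t x, mu (t + x) <= C * (1 + `|t|) `^ k * mu x.

Definition subexp_weight (beta : R) (mu : R -> R) : Prop :=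
  exists C gamma : R, [/\ 0 < C, 0 < gamma &
    forall t x, mu (t + x) <= C * expR (gamma * `|t| `^ beta) * mu x].

Definition ell2_sum (mu : R -> R) (a : nat -> R[i]) : \bar R :=
  (\sum_(n <oo) (cmod (a n) ^+ 2 * mu n.+1%:R ^+ 2)%:E)%E.

Definition ell2 (mu : R -> R) : set (nat -> R[i]) :=
  [set a | (ell2_sum mu a < +oo)%E].

Definition ell2_norm (mu : R -> R) (a : nat -> R[i]) : R :=
  Num.sqrt (fine (ell2_sum mu a)).

End Weights.

(* A space Y_F, the intersection of the Y_k, inside an ambient vector space,
   together with the norms of the Y_k. *)
Record fspace (R : realType) (V : lmodType R[i]) := FSpace {
  fcarrier : set V;
  fnorm : nat -> V -> R }.

Section FSpaces.
Variables (R : realType) (V W : lmodType R[i]).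
Implicit Types (Y : fspace V) (Z : fspace W).

(* Neighbourhoods of [x] in Y for the topology given by the norms. *)
Definition fnbhs Y (x : V) : set_system V :=
  [set A | exists (N : nat) (eps : R), 0 < eps /\
     [set y | fcarrier Y y /\
        forall k, (k <= N)%N -> fnorm Y k (y - x) < eps] `<=` A].

Definition fbounded Y Z (T : V -> W) : Prop :=
  [/\ forall y, fcarrier Y y -> fcarrier Z (T y),
      forall (a : R[i]) y z, fcarrier Y y -> fcarrier Y z ->
        T (a *: y + z) = a *: T y + T z
    & forall k, exists C : R, 0 < C /\
        forall y, fcarrier Y y -> fnorm Z k (T y) <= C * fnorm Y k y].

(* Functionals on Y are given by total functions on the ambient space, whose
   values outside Y are irrelevant. *)
Definition fdual Y : set (V -> R[i]^o) :=
  [set phi : V -> R[i]^o |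
     (forall (a : R[i]) y z, fcarrier Y y -> fcarrier Y z ->
        phi (a *: y + z) = a * phi y + phi z) /\
     (forall x, fcarrier Y x -> phi @ fnbhs Y x --> phi x)].

End FSpaces.

Section FrechetFrames.
Variables (R : realType) (V : lmodType R[i]).

Definition frechet_frame (X : fspace V) (Theta : fspace (nat -> R[i]))
    (phi : nat -> V -> R[i]^o) : Prop :=
  [/\ forall n, fdual X (phi n),
      forall f, fcarrier X f -> fcarrier Theta (phi ^~ f),
      forall k, exists A B : R, [/\ 0 < A, A <= B &
        forall f, fcarrier X f ->
          A * fnorm X k f <= fnorm Theta k (phi ^~ f) /\
          fnorm Theta k (phi ^~ f) <= B * fnorm X k f]
    & exists T : (nat -> R[i]) -> V, fbounded Theta X T /\
        forall f, fcarrier X f -> T (phi ^~ f) = f].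

(* The dual of a sequence space, identified with a space of sequences. *)
Definition fdual_seq (Theta : fspace (nat -> R[i])) : set (nat -> R[i]) :=
  [set a | exists U : (nat -> R[i]) -> R[i]^o, fdual Theta U /\
     forall n, a n = U (fun m => (m == n)%:R)].

End FrechetFrames.

Section Spaces.
Variables (R : realType) (mu : nat -> R -> R).

Definition ThetaF : fspace (nat -> R[i]) :=
  FSpace (\bigcap_k ell2 (mu k)) (fun k => ell2_norm (mu k)).

Variables (H : completeNormedModType R[i]) (ip : {dot H for Num.conj}).
Variable g : nat -> H.

Definition HG (m : R -> R) : set H :=
  [set f | ell2 m (analysis ip (canonical_dual ip g) f)].

Definition HG_norm (m : R -> R) (f : H) : R :=
  ell2_norm m (analysis ip (canonical_dual ip g) f).

Definition XF : fspace H :=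
  FSpace (\bigcap_k HG (mu k)) (fun k => HG_norm (mu k)).

Definition char_property (x : nat -> H) : Prop :=
  forall f : H, fcarrier XF f <-> fcarrier ThetaF (analysis ip x f).

End Spaces.

(* Main.v *)
Require Import Defs.
From HB Require Import structures.
From mathcomp Require Import all_boot all_order all_algebra.
From mathcomp Require Import complex.
From mathcomp Require Import all_classical all_reals all_analysis.
From mathcomp Require Import zify ring lra.

Set Implicit Arguments.
Unset Strict Implicit.
Unset Printing Implicit Defensive.

Import Order.TTheory GRing.Theory Num.Theory.
Import numFieldNormedType.Exports.

Local Open Scope classical_set_scope.
Local Open Scope ring_scope.

(** Let [c f] be the coordinate sequence of [f] with respect to [G], so that
    [X_k] is normed by [mu_k * c f] in l^2. Localization makes the matrices of
    the analysis and synthesis operators of [E] bounded on the weighted spaces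
    (Schur test); the point is that the inverse of the frame operator [S] is
    bounded on [X_k] as well. No Wiener-type algebra of matrices is needed.
    Replace [mu_k] by an equivalent weight [w] with
    [w m <= v_t (|m - n|) * w n], where [v_t d] is [exp (t a d^beta)] or
    [(1 + t d)^k]. Since [v_t - 1 <= t v_1], the commutators of [w] with the
    analysis and synthesis matrices are [O(t)] on the weighted space, so for [t]
    small the lower bound of [S] on [H] yields [|w (c h)| <= C |w (c (S h))|].
    Applying this to the truncations [min(w, N)], for which the left-hand side
    is finite, and letting [N] tend to infinity shows that [S h] in [X_k] implies
    [h] in [X_k], with a norm bound. The expansions, the Fréchet frame property
    and the duality statements then follow by composing the F-bounded operators
    [U_E], [T_E] and [S^-1] and using that the canonical vectors form an
    unconditional basis of [Theta_F]. *)

(** * Square-summable sequences and the Schur test *)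

Section SquareSummable.
Variable R : realType.
Implicit Types (x y : nat -> R) (B C : R).

(** The equivalent weight must satisfy [w m <= v_t (|m - n|) * w n] with constant exactly 1: with a
    constant C > 1 in front, [|w m - w n|] would only be bounded by [(C * v_t - 1) * w n], which
    does not vanish with t. Truncation respects the inequality because [v_t >= 1], so the bound
    obtained for [min(w, N)] is independent of N. Since t depends on the frame bounds and on the
    localization constant, the original weight has to be comparable with [v_t] for every small t.
    This is where beta_k < beta enters: [exp (c d^beta_k)] is at most a constant times
    [exp (t a d^beta)], however small t is; for polynomial weights [t^k (1 + d)^k <= (1 + t d)^k]
    does the same. What is left of the localization after multiplication by [v_1] must still decay
    like [(1 + d)^-2] for the Schur test. Square-summability is expressed by [l2le], a bound on all
    partial sums with an explicit constant, which passes to pointwise limits. *)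

Definition l2le x B := 0 <= B /\ forall N, \sum_(n < N) x n ^+ 2 <= B ^+ 2.

Lemma sum_mul_sqr_le x y N :
  (\sum_(n < N) x n * y n) ^+ 2 <=
  (\sum_(n < N) x n ^+ 2) * (\sum_(n < N) y n ^+ 2).
Proof.
elim: N => [|N IH]; first by rewrite !big_ord0 expr2 mulr0.
rewrite !big_ord_recr /=; move: IH.
have P0 : 0 <= \sum_(n < N) x n ^+ 2 by apply: sumr_ge0 => i _; rewrite sqr_ge0.
have Q0 : 0 <= \sum_(n < N) y n ^+ 2 by apply: sumr_ge0 => i _; rewrite sqr_ge0.
set P := \sum_(n < N) x n ^+ 2 in P0 *.
set Q := \sum_(n < N) y n ^+ 2 in Q0 *.
set S := \sum_(n < N) x n * y n; move: (x N) (y N) => a b IH.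
(* The cross term: as [S^2 <= P Q], this is the inequality between the geometric and arithmetic
   means of [P b^2] and [Q a^2]. *)
suff : 2 * S * (a * b) <= P * b ^+ 2 + Q * a ^+ 2 by nra.
have T0 : 0 <= P * b ^+ 2 + Q * a ^+ 2.
  by apply: addr_ge0; apply: mulr_ge0 => //; rewrite sqr_ge0.
apply: le_trans (ler_norm _) _.
rewrite -(ler_sqr (normr_nneg _)) ?nnegrE // real_normK ?num_real //.
have ab0 : 0 <= (a * b) ^+ 2 by rewrite sqr_ge0.
have e0 := sqr_ge0 (P * b ^+ 2 - Q * a ^+ 2).
have := ler_wpM2r ab0 IH.
have -> : (2 * S * (a * b)) ^+ 2 = 4 * (S ^+ 2 * (a * b) ^+ 2) by ring.
have -> : P * Q * (a * b) ^+ 2 = (P * b ^+ 2) * (Q * a ^+ 2) by ring.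
by nra.
Qed.

Lemma l2le_mul_sum x y B C N : l2le x B -> l2le y C ->
  \sum_(n < N) x n * y n <= B * C.
Proof.
move=> [B0 xB] [C0 yC]; apply: le_trans (ler_norm _) _.
rewrite -(ler_sqr (normr_nneg _)) ?nnegrE ?mulr_ge0 //.
rewrite real_normK ?num_real // exprMn.
apply: le_trans (sum_mul_sqr_le _ _ _) _; apply: ler_pM (xB N) (yC N).
  by apply: sumr_ge0 => i _; rewrite sqr_ge0.
by apply: sumr_ge0 => i _; rewrite sqr_ge0.
Qed.

Lemma l2leD x y B C : l2le x B -> l2le y C -> l2le (fun n => x n + y n) (B + C).
Proof.
move=> xB yC; have [B0 xB'] := xB; have [C0 yC'] := yC.
split=> [|N]; first exact: addr_ge0.
have xy := l2le_mul_sum N xB yC.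
have -> : \sum_(n < N) (x n + y n) ^+ 2 =
  \sum_(n < N) x n ^+ 2 + 2 * (\sum_(n < N) x n * y n) + \sum_(n < N) y n ^+ 2.
  by rewrite mulr_sumr -!big_split /=; apply: eq_bigr => i _; ring.
by have := xB' N; have := yC' N; nra.
Qed.

Lemma l2le_mono x y B : (forall n, `|x n| <= y n) -> l2le y B -> l2le x B.
Proof.
move=> xy [B0 yB]; split=> // N; apply: le_trans (yB N).
apply: ler_sum => i _; rewrite -[leLHS]real_normK ?num_real //.
by apply: lerXn2r (xy i); rewrite nnegrE // (le_trans _ (xy i)).
Qed.

Lemma l2le_weaken x B C : B <= C -> l2le x B -> l2le x C.
Proof.
move=> BC [B0 xB]; have C0 := le_trans B0 BC; split=> // N.
by apply: le_trans (xB N) _; apply: lerXn2r.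
Qed.

Lemma l2leZ x B c : 0 <= c -> l2le x B -> l2le (fun n => c * x n) (c * B).
Proof.
move=> c0 [B0 xB]; split=> [|N]; first exact: mulr_ge0.
under eq_bigr do rewrite exprMn.
by rewrite -mulr_sumr exprMn; apply: ler_wpM2l (xB N); rewrite sqr_ge0.
Qed.

Lemma l2le_pt x B n : l2le x B -> `|x n| <= B.
Proof.
move=> [B0 xB]; rewrite -(ler_sqr (normr_nneg _)) ?nnegrE //.
rewrite real_normK ?num_real //; apply: le_trans (xB n.+1).
by rewrite big_ord_recr /= lerDr; apply: sumr_ge0 => i _; rewrite sqr_ge0.
Qed.

(** Fatou's lemma for sequences: a partial sum depends continuously on finitely many terms. *)
Lemma l2le_lim (z : nat -> nat -> R) y B :
  (forall n, z N n @[N --> \oo] --> y n) -> (forall N, l2le (z N) B) -> l2le y B.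
Proof.
move=> zy zB; split=> [|P]; first by case: (zB 0%N).
have cv : (\sum_(n < P) z N n ^+ 2) @[N --> \oo] --> \sum_(n < P) y n ^+ 2.
  elim: P => [|P IH]; first by under eq_fun do rewrite big_ord0; rewrite big_ord0; exact: cvg_cst.
  under eq_fun do rewrite big_ord_recr /= expr2.
  by rewrite big_ord_recr /= expr2; apply: cvgD IH _; exact: cvgM.
rewrite -(cvg_lim _ cv) //; apply: limr_le; first by apply/cvg_ex; eexists; exact: cv.
by apply: nearW => N; case: (zB N).
Qed.

Lemma l2le_tail x B e : l2le x B -> 0 < e ->
  exists M, l2le (fun n => if (n < M)%N then 0 else x n) e.
Proof.
move=> [B0 xB] e0.
pose s N := \sum_(n < N) x n ^+ 2.
have hs : has_sup (range s).
  by split; [exists (s 0%N), 0%N | exists (B ^+ 2) => _ [N _ <-]; exact: xB].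
have e2 : 0 < e ^+ 2 by rewrite exprn_gt0.
(* The partial sum up to [M] is within [e^2] of the supremum, so all later terms contribute at most
   [e^2]. *)
have [_ [M _ <-] sM] := sup_adherent e2 hs.
exists M; split=> [|N]; first exact: ltW.
have smono k : s (M + k)%N = s M + \sum_(i < k) x (M + i)%N ^+ 2.
  by rewrite /s big_split_ord.
have tail k : \sum_(n < M + k) (if (n < M)%N then 0 else x n) ^+ 2 =
    \sum_(i < k) x (M + i)%N ^+ 2.
  rewrite big_split_ord /= big1 ?add0r => [|i _]; last by rewrite ltn_ord expr2 mul0r.
  by apply: eq_bigr => i _; rewrite ltnNge leq_addr.
apply: (@le_trans _ _ (\sum_(n < M + N) (if (n < M)%N then 0 else x n) ^+ 2)).
  rewrite addnC big_split_ord /= lerDl.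
  by apply: sumr_ge0 => i _; rewrite sqr_ge0.
have : s (M + N)%N <= sup (range s).
  by apply: sup_upper_bound => //; exists (M + N)%N.
by rewrite tail smono; lra.
Qed.


(** With [K = sqrt K * sqrt K], Cauchy-Schwarz in each row uses the row sums, and exchanging the
    summations leaves the column sums. The cut at [N] keeps the inner sum finite. *)
Lemma schur (K : nat -> nat -> R) x B C N : (forall m n, 0 <= K m n) ->
    (forall m P, \sum_(n < P) K m n <= C) ->
    (forall n P, \sum_(m < P) K m n <= C) ->
  l2le x B -> l2le (fun m => \sum_(n < N) K m n * `|x n|) (C * B).
Proof.
move=> K0 Kr Kc [B0 xB].
have C0 : 0 <= C by have := Kr 0%N 0%N; rewrite big_ord0.
split=> [|P]; first exact: mulr_ge0.
have row m : (\sum_(n < N) K m n * `|x n|) ^+ 2 <= C * \sum_(n < N) K m n * x n ^+ 2.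
  have -> : \sum_(n < N) K m n * `|x n| =
      \sum_(n < N) Num.sqrt (K m n) * (Num.sqrt (K m n) * `|x n|).
    by apply: eq_bigr => i _; rewrite mulrA -expr2 sqr_sqrtr.
  apply: le_trans (sum_mul_sqr_le (fun n => Num.sqrt (K m n))
     (fun n => Num.sqrt (K m n) * `|x n|) N) _.
  have -> : \sum_(n < N) (Num.sqrt (K m n) * `|x n|) ^+ 2 =
      \sum_(n < N) K m n * x n ^+ 2.
    by apply: eq_bigr => i _; rewrite exprMn sqr_sqrtr // real_normK ?num_real.
  apply: ler_wpM2r.
    by apply: sumr_ge0 => i _; rewrite mulr_ge0 ?sqr_ge0.
  by under eq_bigr do rewrite sqr_sqrtr //.
apply: (@le_trans _ _ (\sum_(m < P) C * \sum_(n < N) K m n * x n ^+ 2)).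
  by apply: ler_sum => i _; exact: row.
rewrite -mulr_sumr exchange_big /= exprMn expr2 -mulrA; apply: ler_wpM2l => //.
apply: (@le_trans _ _ (\sum_(n < N) C * x n ^+ 2)).
  apply: ler_sum => i _; rewrite -mulr_suml; apply: ler_wpM2r (Kc _ _).
  exact: sqr_ge0.
by rewrite -mulr_sumr; apply: ler_wpM2l.
Qed.

Definition dist (m n : nat) : nat := ((m - n) + (n - m))%N.

Lemma distE m n : (dist m n)%:R = idist R m n.
Proof.
rewrite /dist /idist; have [mn|nm] := leqP m n.
  by rewrite (eqP mn) add0n natrB // distrC ger0_norm // subr_ge0 ler_nat.
rewrite (eqP (ltnW nm)) addn0 natrB 1?ltnW // ger0_norm // subr_ge0 ler_nat.
exact: ltnW.
Qed.

(** Each side of the diagonal contributes at most 2, by comparison with the telescoping bound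
    [1 / (N+2)^2 <= 1 / (N+1) - 1 / (N+2)]. *)
Lemma sum_dist_row m P : \sum_(n < P) ((1 + (dist m n)%:R) ^+ 2)^-1 <= 4 :> R.
Proof.
pose q (d : nat) : R := ((1 + d%:R) ^+ 2)^-1.
have q0 d : 0 <= q d by rewrite invr_ge0 sqr_ge0.
have qsum N : \sum_(d < N) q d <= 2.
  suff : \sum_(d < N.+1) q d <= 2 - N.+1%:R^-1.
    rewrite big_ord_recr /=; have := q0 N.
    have : 0 <= N.+1%:R^-1 :> R by rewrite invr_ge0.
    move: (q N) (_^-1) (\sum_(i < N) q i) => u v w; lra.
  elim: N => [|N IH].
    by rewrite big_ord_recr big_ord0 /= /q; rewrite add0r addr0 expr1n invr1; lra.
  rewrite big_ord_recr /=; apply: le_trans (lerD IH (lexx _)) _.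
  have -> : N.+2%:R = N.+1%:R + 1 :> R by rewrite -natr1.
  rewrite /q; set a : R := N.+1%:R; have a0 : 0 < a by rewrite ltr0n.
  rewrite -subr_ge0.
  have -> : 2 - (a + 1)^-1 - (2 - a^-1 + ((1 + a) ^+ 2)^-1) = (a * (1 + a) ^+ 2)^-1.
    by field; rewrite !gt_eqF //; lra.
  by rewrite invr_ge0 mulr_ge0 ?sqr_ge0 // ltW.
have half1 m' : \sum_(n < m') q (dist m' n) <= 2.
  rewrite (reindex_inj rev_ord_inj) /=; apply: le_trans (qsum m').
  apply: ler_sum => i _; rewrite lef_pV2 ?posrE ?exprn_gt0 ?ltr_pwDl //.
  apply: lerXn2r; rewrite ?nnegrE ?addr_ge0 //; rewrite lerD2l ler_nat /dist.
  by have := ltn_ord i; lia.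
have [Pm|mP] := leqP P m.
  apply: le_trans (_ : \sum_(n < m) q (dist m n) <= _); last by have := half1 m; lra.
  by rewrite -(subnKC Pm) big_split_ord /= lerDl; apply: sumr_ge0.
rewrite -(subnKC (ltnW mP)) big_split_ord /=.
have : \sum_(i < P - m) q (dist m (m + i)) <= 2.
  apply: le_trans (qsum (P - m)%N); apply: ler_sum => i _.
  by rewrite /dist addKn subnDA subnn sub0n add0n.
by have := half1 m; rewrite /q; lra.
Qed.

Lemma schur_dist (K : nat -> nat -> R) M x B N : 0 <= M ->
    (forall m n, 0 <= K m n <= M * ((1 + (dist m n)%:R) ^+ 2)^-1) ->
  l2le x B ->
  l2le (fun m => \sum_(n < N) K m n * `|x n|) (4 * M * B) /\
  l2le (fun n => \sum_(m < N) K m n * `|x m|) (4 * M * B).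
Proof.
move=> M0 KM xB.
have dC m n : dist m n = dist n m by rewrite /dist addnC.
have r m P : \sum_(n < P) K m n <= 4 * M.
  apply: (@le_trans _ _ (\sum_(n < P) M * ((1 + (dist m n)%:R) ^+ 2)^-1)).
    by apply: ler_sum => i _; case/andP: (KM m i).
  by rewrite -mulr_sumr mulrC; apply: ler_wpM2r (sum_dist_row _ _).
have c n P : \sum_(m < P) K m n <= 4 * M.
  apply: (@le_trans _ _ (\sum_(m < P) M * ((1 + (dist n m)%:R) ^+ 2)^-1)).
    by apply: ler_sum => i _; rewrite dC; case/andP: (KM i n).
  by rewrite -mulr_sumr mulrC; apply: ler_wpM2r (sum_dist_row _ _).
have K0 m n : 0 <= K m n by case/andP: (KM m n).
by split; [apply: schur | apply: (@schur (fun m n => K n m))].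
Qed.

Lemma ell2_l2le (mu : R -> R) (a : nat -> R[i]) B :
    l2le (fun n => cmod (a n) * mu n.+1%:R) B ->
  ell2 mu a /\ ell2_norm mu a <= B.
Proof.
move=> [B0 aB].
have le : (ell2_sum mu a <= (B ^+ 2)%:E)%E.
  apply: lime_le; first by apply: is_cvg_nneseries => n _ _; rewrite lee_fin mulr_ge0 ?sqr_ge0.
  apply: nearW => N; rewrite sumEFin lee_fin big_mkord.
  by have := aB N; under eq_bigr do rewrite exprMn.
have ge : (0 <= ell2_sum mu a)%E.
  by apply: nneseries_ge0 => n _ _; rewrite lee_fin mulr_ge0 ?sqr_ge0.
split; first by apply: le_lt_trans le (ltry _).
rewrite /ell2_norm -[leRHS](ger0_norm B0) -sqrtr_sqr ler_wsqrtr // -lee_fin fineK //.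
by rewrite ge0_fin_numE //; apply: le_lt_trans le (ltry _).
Qed.

Lemma l2le_ell2 (mu : R -> R) (a : nat -> R[i]) : ell2 mu a ->
  l2le (fun n => cmod (a n) * mu n.+1%:R) (ell2_norm mu a).
Proof.
move=> aE; split=> [|N]; first exact: sqrtr_ge0.
have ge : (0 <= ell2_sum mu a)%E.
  by apply: nneseries_ge0 => n _ _; rewrite lee_fin mulr_ge0 ?sqr_ge0.
rewrite /ell2_norm sqr_sqrtr ?fine_ge0 // -lee_fin fineK ?ge0_fin_numE //.
rewrite -sumEFin.
under eq_bigr do rewrite exprMn.
rewrite -(big_mkord xpredT (fun n => (cmod (a n) ^+ 2 * mu n.+1%:R ^+ 2)%:E)).
by apply: nneseries_lim_ge => n _ _; rewrite lee_fin mulr_ge0 ?sqr_ge0.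
Qed.

End SquareSummable.

(** * Inner product and convergence *)

Section InnerProduct.
Variables (R : realType) (H : completeNormedModType R[i]).
Variable ip : {dot H for Num.conj}.
Hypothesis ip_norm : hilbert_norm ip.
Implicit Types (x y z f : H) (a : R[i]).

Lemma normr_cmod (a : R[i]) : `|a| = (cmod a)%:C%C.
Proof. by rewrite normc_def; case: a. Qed.

Lemma cmodE a : cmod a = complex.Re `|a|.
Proof. by rewrite normr_cmod. Qed.

Lemma cmod_ge0 a : 0 <= cmod a.
Proof. by case: a => u v; rewrite sqrtr_ge0. Qed.

Lemma cmodD a b : cmod (a + b) <= cmod a + cmod b.
Proof. exact: le_normcD. Qed.

Lemma cmod_conj a : cmod (a^*)%R = cmod a.
Proof. by rewrite !cmodE norm_conjC. Qed.

Lemma cmod_real (r : R) : cmod r%:C%C = `|r|.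
Proof. by rewrite /= expr0n /= addr0 sqrtr_sqr. Qed.

Lemma cmod_sum (I : Type) (r : seq I) (F : I -> R[i]) :
  cmod (\sum_(n <- r) F n) <= \sum_(n <- r) cmod (F n).
Proof.
elim: r => [|n r IH]; first by rewrite !big_nil ComplexField.Normc.normc0.
by rewrite !big_cons; apply: le_trans (cmodD _ _) _; rewrite lerD2l.
Qed.

Lemma normr_hnorm x : `|x| = (hnorm x)%:C%C.
Proof. by rewrite /hnorm RRe_real // ger0_real. Qed.

Lemma hnorm_ge0 x : 0 <= hnorm x.
Proof. by rewrite -lecR -normr_hnorm; exact: normr_ge0. Qed.

Lemma hnorm0 : hnorm (0 : H) = 0.
Proof. by rewrite /hnorm normr0. Qed.

Lemma hnorm_eq0 x : hnorm x = 0 -> x = 0.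
Proof. by move=> x0; apply/eqP; rewrite -normr_eq0 normr_hnorm x0. Qed.

Lemma hnormN x : hnorm (- x) = hnorm x.
Proof. by rewrite /hnorm normrN. Qed.

Lemma hnormD x y : hnorm (x + y) <= hnorm x + hnorm y.
Proof.
by rewrite -lecR rmorphD /= -!normr_hnorm; exact: ler_normD.
Qed.

Lemma hnormBC x y : hnorm (x - y) = hnorm (y - x).
Proof. by rewrite -hnormN opprB. Qed.

Lemma hnormZ a x : hnorm (a *: x) = cmod a * hnorm x.
Proof.
by apply: (@complexI R); rewrite rmorphM /= -!normr_hnorm -normr_cmod normrZ.
Qed.

Lemma ip_hnorm x : ip x x = (hnorm x ^+ 2)%:C%C.
Proof. by rewrite -ip_norm normr_hnorm rmorphXn. Qed.

Lemma ipC x y : ip x y = ((ip y x)^*)%R.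
Proof. by rewrite [LHS]hermC expr0 mul1r. Qed.

Lemma ipDl x y z : ip (x + y) z = ip x z + ip y z.
Proof. by rewrite linearDl. Qed.
Lemma ipBl x y z : ip (x - y) z = ip x z - ip y z.
Proof. by rewrite linearBl. Qed.
Lemma ipBr x y z : ip x (y - z) = ip x y - ip x z.
Proof. by rewrite linearBr. Qed.
Lemma ipZl a x y : ip (a *: x) y = a * ip x y.
Proof. by rewrite linearZl_LR. Qed.
Lemma ipZr a x y : ip x (a *: y) = (a^*)%R * ip x y.
Proof. by rewrite linearZr_LR. Qed.
Lemma ip0l x : ip 0 x = 0.
Proof. by rewrite linear0l. Qed.
Lemma ip0r x : ip x 0 = 0.
Proof. by rewrite linear0r. Qed.

Lemma ip_suml (I : Type) (r : seq I) (F : I -> H) y :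
  ip (\sum_(n <- r) F n) y = \sum_(n <- r) ip (F n) y.
Proof.
elim: r => [|n r IH]; first by rewrite !big_nil ip0l.
by rewrite !big_cons ipDl IH.
Qed.

Lemma cmod_ipC x y : cmod (ip x y) = cmod (ip y x).
Proof. by rewrite ipC cmod_conj. Qed.

Lemma cauchy_schwarz x y : cmod (ip x y) <= hnorm x * hnorm y.
Proof.
have [->|y0] := eqVneq y 0.
  by rewrite ip0r ComplexField.Normc.normc0 hnorm0 mulr0.
set p := ip x y; set s := (hnorm y ^+ 2)^-1.
have hy : 0 < hnorm y.
  by rewrite lt_neqAle hnorm_ge0 andbT eq_sym; apply: contra_neq y0; exact: hnorm_eq0.
have pp : p * (p^*)%R = (cmod p ^+ 2)%:C%C by rewrite -normCK normr_cmod rmorphXn.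
(* The vector is [x] minus its projection onto [y]; its squared norm is nonnegative. *)
have := ip_hnorm (x - (s%:C%C * p) *: y).
rewrite ipBl !ipBr !ipZl !ipZr (ipC y x) -/p !ip_hnorm.
have -> : ((s%:C%C * p)^*)%R = s%:C%C * (p^*)%R.
  rewrite rmorphM /=; congr (_ * _); by apply/CrealP/complex_realP; exists s.
have -> : (hnorm x ^+ 2)%:C%C - s%:C%C * (p^*)%R * p -
   (s%:C%C * p * (p^*)%R - s%:C%C * p * (s%:C%C * (p^*)%R * (hnorm y ^+ 2)%:C%C)) =
   (hnorm x ^+ 2)%:C%C - s%:C%C * (p * (p^*)%R) *+ 2 +
    s%:C%C ^+ 2 * (p * (p^*)%R) * (hnorm y ^+ 2)%:C%C by ring.
rewrite pp -!(rmorphM, rmorphXn, rmorphMn, rmorphB, rmorphD) => /complexI.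
have -> : hnorm x ^+ 2 - (s * cmod p ^+ 2) *+ 2 + s ^+ 2 * cmod p ^+ 2 * hnorm y ^+ 2 =
    hnorm x ^+ 2 - cmod p ^+ 2 / hnorm y ^+ 2.
  by rewrite /s; field; rewrite gt_eqF.
move=> E; have := sqr_ge0 (hnorm (x - (s%:C%C * p) *: y)).
rewrite -E subr_ge0 ler_pdivrMr ?exprn_gt0 // -exprMn ler_sqr ?nnegrE ?cmod_ge0 //.
by rewrite mulr_ge0 ?hnorm_ge0.
Qed.

Lemma hcvgP (u : nat -> H) (l : H) : (u @ \oo --> l) <->
  forall e : R, 0 < e -> exists N, forall n, (N <= n)%N -> hnorm (u n - l) < e.
Proof.
split.
  move/cvgrPdist_lt => ul e e0; have e0' : 0 < (e%:C)%C by rewrite ltcR.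
  have [N _ uN] := ul _ e0'; exists N => n Nn.
  by have := uN n Nn; rewrite /= normr_hnorm ltcR hnormBC.
move=> ul; apply/cvgrPdist_lt => e e0.
have er : e = (complex.Re e)%:C%C by rewrite RRe_real // gtr0_real.
have e0' : 0 < complex.Re e by rewrite -ltcR -er.
have [N uN] := ul _ e0'; exists N => // n Nn.
by rewrite /= normr_hnorm er ltcR hnormBC; exact: uN.
Qed.

Lemma ccvgP (u : nat -> R[i]^o) (l : R[i]^o) : (u @ \oo --> l) <->
  forall e : R, 0 < e -> exists N, forall n, (N <= n)%N -> cmod (u n - l) < e.
Proof.
split.
  move/cvgrPdist_lt => ul e e0; have e0' : 0 < (e%:C)%C by rewrite ltcR.
  have [N _ uN] := ul _ e0'; exists N => n Nn.
  by have := uN n Nn; rewrite /= distrC normr_cmod ltcR.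
move=> ul; apply/cvgrPdist_lt => e e0.
have er : e = (complex.Re e)%:C%C by rewrite RRe_real // gtr0_real.
have e0' : 0 < complex.Re e by rewrite -ltcR -er.
have [N uN] := ul _ e0'; exists N => // n Nn.
by rewrite /= distrC normr_cmod er ltcR; exact: uN.
Qed.

Lemma hcauchy (u : nat -> H) :
  (forall e : R, 0 < e -> exists N, forall n, (N <= n)%N -> hnorm (u n - u N) < e) ->
  exists l : H, u @ \oo --> l.
Proof.
move=> uC; suff cu : cvg (u @ \oo) by exists (lim (u @ \oo)).
apply/cauchy_cvgP; apply/cauchy_exP => e e0.
have er : e = (complex.Re e)%:C%C by rewrite RRe_real // gtr0_real.
have e0' : 0 < complex.Re e by rewrite -ltcR -er.
have [N uN] := uC _ e0'; exists (u N), N => // n Nn.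
by rewrite -ball_normE /= er normr_hnorm ltcR hnormBC; exact: uN.
Qed.

Lemma hlim_unique (u : nat -> H) (l l' : H) : u @ \oo --> l -> u @ \oo --> l' -> l = l'.
Proof. by move=> ul ul'; apply: (cvg_unique _ ul ul'); exact: norm_hausdorff. Qed.

Lemma clim_unique (u : nat -> R[i]^o) (l l' : R[i]^o) :
  u @ \oo --> l -> u @ \oo --> l' -> l = l'.
Proof. by move=> ul ul'; apply: (cvg_unique _ ul ul'); exact: norm_hausdorff. Qed.

Lemma ip_cvg (u : nat -> H) (l y : H) : u @ \oo --> l ->
  (fun n => ip (u n) y : R[i]^o) @ \oo --> (ip l y : R[i]^o).
Proof.
move=> /hcvgP ul; apply/ccvgP => e e0.
have y0 : 0 < 1 + hnorm y by rewrite ltr_pwDl // hnorm_ge0.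
have [N uN] := ul _ (divr_gt0 e0 y0); exists N => n Nn.
rewrite -ipBl; apply: le_lt_trans (cauchy_schwarz _ _) _.
have := uN n Nn; rewrite ltr_pdivlMr //; apply: le_lt_trans.
by rewrite ler_wpM2l ?hnorm_ge0 // lerDr.
Qed.

Lemma hnorm_le_lim (u : nat -> H) (l x : H) (B : R) : u @ \oo --> l ->
  (forall n, hnorm (u n - x) <= B) -> hnorm (l - x) <= B.
Proof.
move=> /hcvgP ul uB; apply/ler_addgt0Pr => e e0.
have [N uN] := ul _ e0.
have -> : l - x = (u N - x) + (l - u N) by rewrite [RHS]addrC addrA subrK.
apply: le_trans (hnormD _ _) _; apply: lerD (uB N) _.
by rewrite hnormBC; apply/ltW/uN.
Qed.

(** Serves the iteration that inverts the frame operator and, through its error bound, the gliding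
    hump argument. *)
Lemma geometric_cvg (u : nat -> H) (C q : R) : 0 <= C -> 0 <= q < 1 ->
  (forall n, hnorm (u n.+1 - u n) <= C * q ^+ n) ->
  exists l : H, u @ \oo --> l /\ forall n, hnorm (l - u n) <= C * q ^+ n / (1 - q).
Proof.
move=> C0 /andP[q0 q1] uC.
have q1' : 0 < 1 - q by rewrite subr_gt0.
have step n k : hnorm (u (n + k)%N - u n) <= C * q ^+ n * (1 - q ^+ k) / (1 - q).
  elim: k => [|k IH]; first by rewrite addn0 subrr hnorm0 expr0 subrr mulr0 mul0r.
  have -> : u (n + k.+1)%N - u n = (u (n + k).+1 - u (n + k)%N) + (u (n + k)%N - u n).
    by rewrite addnS addrA subrK.
  apply: le_trans (hnormD _ _) _; apply: le_trans (lerD (uC _) IH) _.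
  rewrite exprD exprS -subr_ge0.
  rewrite [leRHS](_ : _ = 0) //; by field; rewrite gt_eqF.
have bnd n k : hnorm (u (n + k)%N - u n) <= C * q ^+ n / (1 - q).
  apply: le_trans (step n k) _; apply: ler_wpM2r; first by rewrite invr_ge0 ltW.
  by apply: ler_piMr; rewrite ?mulr_ge0 ?exprn_ge0 // gerBl exprn_ge0.
have qn : (fun n => C * q ^+ n / (1 - q)) @ \oo --> (0 : R).
  have -> : 0 = C * 0 / (1 - q) :> R by rewrite mulr0 mul0r.
  apply: cvgMl; apply: cvgMr; apply: cvg_expr; by rewrite ger0_norm.
have [l ul] : exists l : H, u @ \oo --> l.
  apply: hcauchy => e e0; move/cvgrPdist_lt: qn => /(_ e e0)[N _ qN].
  exists N => n Nn; rewrite -(subnKC Nn); apply: le_lt_trans (bnd _ _) _.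
  apply: le_lt_trans (qN N (leqnn N)); rewrite sub0r normrN; exact: ler_norm.
exists l; split=> // n; apply: (@hnorm_le_lim (fun k => u (n + k)%N)) (bnd n).
apply/hcvgP => e e0; move/hcvgP: ul => /(_ e e0)[N uN]; exists N => k Nk.
by apply: uN; apply: leq_trans Nk (leq_addl _ _).
Qed.

End InnerProduct.

(** * Frame operators *)

Section Frames.
Variables (R : realType) (H : completeNormedModType R[i]).
Variable ip : {dot H for Num.conj}.
Hypothesis ip_norm : hilbert_norm ip.
Implicit Types (x y z f : H) (a : R[i]) (c d : nat -> R[i]).

Definition l2 c := exists C, l2le (fun n => cmod (c n)) C.

(** The constant bounds the analysis operator itself, so it is the square root of a frame bound;
    likewise in [lower_bound]. *)
Definition bessel (e : nat -> H) (B : R) := 0 <= B /\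
  forall f, l2le (fun n => cmod (ip f (e n))) (B * hnorm f).

Definition lower_bound (e : nat -> H) (al : R) := 0 < al /\
  forall f C, l2le (fun n => cmod (ip f (e n))) C -> al * hnorm f <= C.

Lemma frame_bessel_lower e : frame ip e ->
  exists al B, [/\ al <= B, bessel e B & lower_bound e al].
Proof.
move=> [A [B [A0 B0 AB]]].
have sB f : l2le (fun n => cmod (ip f (e n))) (Num.sqrt B * hnorm f).
  split=> [|N]; first by rewrite mulr_ge0 ?sqrtr_ge0 ?hnorm_ge0.
  rewrite exprMn sqr_sqrtr ?(ltW B0) // -lee_fin.
  apply: le_trans (AB f).2; rewrite -sumEFin.
  rewrite -(big_mkord xpredT (fun n => (cmod (ip f (e n)) ^+ 2)%:E)).
  by apply: nneseries_lim_ge => n _ _; rewrite lee_fin sqr_ge0.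
(* On the zero space the frame inequality does not relate [A] and [B]; the maximum secures
   [al <= B]. *)
exists (Num.sqrt A), (Num.max (Num.sqrt A) (Num.sqrt B)); split.
- by rewrite le_max lexx.
- split=> [|f]; first by rewrite le_max sqrtr_ge0.
  apply: l2le_weaken (sB f); apply: ler_wpM2r; first exact: hnorm_ge0.
  by rewrite le_max lexx orbT.
split=> [|f C [C0 fC]]; first by rewrite sqrtr_gt0.
rewrite -ler_sqr ?nnegrE ?mulr_ge0 ?sqrtr_ge0 ?hnorm_ge0 //.
rewrite exprMn sqr_sqrtr ?(ltW A0) // -lee_fin.
apply: le_trans (AB f).1 _; apply: lime_le.
  by apply: is_cvg_nneseries => n _ _; rewrite lee_fin sqr_ge0.
by apply: nearW => N; rewrite sumEFin lee_fin big_mkord; exact: fC.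
Qed.

Section Bessel.
Variables (e : nat -> H) (B : R).
Hypothesis eB : bessel e B.

(** By duality: pairing the sum [y] with itself produces the analysis coefficients of [y], and one
    factor [hnorm y] cancels. *)
Lemma hnorm_sum_le c C N : l2le (fun n => cmod (c n)) C ->
  hnorm (\sum_(n < N) c n *: e n) <= B * C.
Proof.
move=> cC; have [B0 fB] := eB; have [C0 _] := cC.
set y := \sum_(n < N) _.
have : hnorm y ^+ 2 <= C * (B * hnorm y).
  rewrite -(ger0_norm (sqr_ge0 (hnorm y))) -cmod_real -(ip_hnorm ip_norm).
  have -> : ip y y = \sum_(n < N) ip (c n *: e n) y by rewrite -ip_suml.
  apply: le_trans (cmod_sum _ _) _.
  apply: le_trans (l2le_mul_sum N cC (fB y)).
  by apply: ler_sum => i _; rewrite ipZl ComplexField.Normc.normcM cmod_ipC.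
have [->|y0] := eqVneq (hnorm y) 0; first by rewrite mulr_ge0.
have y1 : 0 < hnorm y by rewrite lt_neqAle eq_sym y0 hnorm_ge0.
by rewrite expr2 mulrA ler_pM2r // mulrC.
Qed.

Lemma series_sumE (V : zmodType) (u : nat -> V) n : series u n = \sum_(k < n) u k.
Proof. by rewrite /series /= big_mkord. Qed.

Lemma synthesis_cvg c : l2 c ->
  series (fun n => c n *: e n) @ \oo --> synthesis e c.
Proof.
move=> [C cC]; have [B0 fB] := eB.
suff [l ul] : exists l : H, series (fun n => c n *: e n) @ \oo --> l.
  rewrite /synthesis.
  have -> // : lim (series (fun n => c n *: e n) @ \oo) = l.
  exact: (cvg_lim (@norm_hausdorff _ _) ul).
apply: hcauchy => ep ep0.
have ep1 : 0 < ep / (B + 1) by rewrite divr_gt0 // ltr_wpDl.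
have [M tM] := l2le_tail cC ep1.
exists M => n Mn; rewrite !series_sumE -(subnKC Mn) big_split_ord /= addrAC subrr add0r.
have -> : \sum_(i < n - M) c (M + i)%N *: e (M + i)%N =
   \sum_(k < M + (n - M)) (if (k < M)%N then 0 else c k) *: e k.
  rewrite big_split_ord /= [X in _ = X + _]big1 ?add0r => [|i _]; last by rewrite ltn_ord scale0r.
  by apply: eq_bigr => i _; rewrite ltnNge leq_addr.
have tM' : l2le (fun n => cmod (if (n < M)%N then 0 else c n)) (ep / (B + 1)).
  apply: l2le_mono tM => k; rewrite ger0_norm ?cmod_ge0 //.
  by case: ifP => // _; rewrite ComplexField.Normc.normc0.
apply: le_lt_trans (hnorm_sum_le _ tM') _.
rewrite mulrA ltr_pdivrMr ?ltr_wpDl // mulrC ltr_pM2l //.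
by rewrite ltrDl.
Qed.

Lemma hnorm_synthesis c C : l2le (fun n => cmod (c n)) C ->
  hnorm (synthesis e c) <= B * C.
Proof.
move=> cC; have := synthesis_cvg (ex_intro _ C cC) => ul.
rewrite -[synthesis _ _]subr0; apply: hnorm_le_lim ul _ => n.
by rewrite subr0 series_sumE; exact: hnorm_sum_le.
Qed.

Lemma ip_synthesis c y : l2 c ->
  series (fun n => c n * ip (e n) y : R[i]^o) @ \oo --> (ip (synthesis e c) y : R[i]^o).
Proof.
move=> /synthesis_cvg /(ip_cvg ip_norm (y := y)).
rewrite [X in X @ _](_ : _ = series (fun n => c n * ip (e n) y : R[i]^o)) //.
apply/funext => n; rewrite !series_sumE ip_suml.
by apply: eq_bigr => i _; rewrite ipZl.
Qed.

Lemma l2_analysis f : l2 (analysis ip e f).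
Proof. by exists (B * hnorm f); case: eB => _; apply. Qed.

Lemma synthesis_lin a c d : l2 c -> l2 d ->
  synthesis e (fun n => a * c n + d n) = a *: synthesis e c + synthesis e d.
Proof.
move=> [C cC] [D dD]; apply/esym.
have cd : l2 (fun n => a * c n + d n).
  exists (cmod a * C + D); apply: l2le_mono (l2leD (l2leZ (cmod_ge0 a) cC) dD) => n.
  rewrite ger0_norm ?cmod_ge0 // -ComplexField.Normc.normcM; exact: cmodD.
apply: hlim_unique (synthesis_cvg cd).
have /hcvgP cc := synthesis_cvg (ex_intro _ C cC).
have /hcvgP dd := synthesis_cvg (ex_intro _ D dD).
apply/hcvgP => ep ep0.
have a1 : 0 < 2 * (cmod a + 1) by rewrite mulr_gt0 // ltr_wpDl // cmod_ge0.
have [N1 c1] := cc _ (divr_gt0 ep0 a1).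
have [N2 d2] := dd _ (divr_gt0 ep0 (ltr0Sn R 1)).
exists (maxn N1 N2) => n; rewrite geq_max => /andP[n1 n2].
have -> : series (fun n => (a * c n + d n) *: e n) n -
    (a *: synthesis e c + synthesis e d) =
   a *: (series (fun n => c n *: e n) n - synthesis e c) +
   (series (fun n => d n *: e n) n - synthesis e d).
  rewrite !series_sumE scalerBr scaler_sumr opprD addrACA -big_split /=.
  by congr (_ + _); apply: eq_bigr => i _; rewrite scalerDl scalerA.
apply: le_lt_trans (hnormD _ _) _; rewrite hnormZ.
have := d2 n n2; have := c1 n n1; have := cmod_ge0 a.
set u := hnorm _; set v := hnorm _; set w := cmod a => w0.
rewrite ltr_pdivlMr // ltr_pdivlMr // => h1 h2.
have u0 : 0 <= u by exact: hnorm_ge0.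
by nra.
Qed.

Let S := frame_op ip e.

Lemma analysis_lin a f y : analysis ip e (a *: f + y) =
  fun n => a * analysis ip e f n + analysis ip e y n.
Proof. by apply/funext => n; rewrite /analysis ipDl ipZl. Qed.

Lemma frame_op_lin a f y : S (a *: f + y) = a *: S f + S y.
Proof. by rewrite /S /frame_op analysis_lin synthesis_lin //; exact: l2_analysis. Qed.

Lemma frame_opB f y : S (f - y) = S f - S y.
Proof. by rewrite addrC -scaleN1r frame_op_lin scaleN1r addrC. Qed.

Lemma hnorm_frame_op f : hnorm (S f) <= B ^+ 2 * hnorm f.
Proof. by rewrite expr2 -mulrA; apply: hnorm_synthesis; case: eB => _; apply. Qed.

Lemma ip_frame_op f y : ip (S f) y = ip f (S y).
Proof.
rewrite (ipC ip f).
apply: (clim_unique (ip_synthesis (y := y) (l2_analysis f))).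
have /ccvgP cv := ip_synthesis (y := f) (l2_analysis y).
apply/ccvgP => ep ep0; have [N uN] := cv _ ep0; exists N => n Nn.
have := uN n Nn; rewrite -[X in X < _ -> _]cmod_conj rmorphB /=.
rewrite !series_sumE rmorph_sum.
rewrite (eq_bigr (fun k : 'I_n => analysis ip e f k * ip (e k) y)) // => k _.
by rewrite rmorphM /= /analysis -!ipC mulrC.
Qed.

Variable al : R.
Hypothesis eal : lower_bound e al.

(** The witness is the sum of the squared moduli of the coefficients, given as a real number so that
    it can be compared in [R]. *)
Lemma frame_op_pos f : exists2 p : R,
  ip (S f) f = p%:C%C & al ^+ 2 * hnorm f ^+ 2 <= p.
Proof.
have [B0 fB] := eB; have [al0 fal] := eal.
pose s n := \sum_(k < n) cmod (ip f (e k)) ^+ 2.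
have smono : {homo s : m n / (m <= n)%N >-> m <= n}.
  move=> m n mn; rewrite /s -(subnKC mn) big_split_ord /= lerDl.
  by apply: sumr_ge0 => i _; exact: sqr_ge0.
have cs : cvgn s.
  apply: nondecreasing_is_cvgn => //; exists ((B * hnorm f) ^+ 2) => _ [n _ <-].
  by case: (fB f) => _; apply.
have sp n : s n <= limn s by apply: nondecreasing_cvgn_le.
have p0 : 0 <= limn s by apply: le_trans (sp 0%N); rewrite /s big_ord0.
exists (limn s).
  apply: (clim_unique (ip_synthesis (y := f) (l2_analysis f))).
  apply/ccvgP => ep ep0; move/cvgrPdist_lt: cs => /(_ ep ep0)[N _ sN].
  exists N => n Nn; have := sN n Nn; rewrite /= distrC.
  have -> : series (fun n => analysis ip e f n * ip (e n) f : R[i]^o) n = (s n)%:C%C.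
    rewrite series_sumE rmorph_sum; apply: eq_bigr => k _.
    by rewrite /analysis (ipC ip (e k)) -normCK normr_cmod rmorphXn.
  by rewrite -rmorphB cmod_real.
have : al * hnorm f <= Num.sqrt (limn s).
  apply: fal; split=> [|N]; first exact: sqrtr_ge0.
  by rewrite sqr_sqrtr //; exact: sp.
by rewrite -ler_sqr ?nnegrE ?mulr_ge0 ?hnorm_ge0 ?sqrtr_ge0 ?(ltW al0) // exprMn sqr_sqrtr.
Qed.

Lemma frame_op_below f : al ^+ 2 * hnorm f <= hnorm (S f).
Proof.
have [p E le] := frame_op_pos f.
have [->|f0] := eqVneq (hnorm f) 0; first by rewrite mulr0 hnorm_ge0.
have f1 : 0 < hnorm f by rewrite lt_neqAle eq_sym f0 hnorm_ge0.
rewrite -(ler_pM2r f1) -mulrA -expr2; apply: le_trans le _.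
apply: le_trans (ler_norm _) _; rewrite -cmod_real -E; exact: cauchy_schwarz.
Qed.

Lemma frame_op_inj f y : S f = S y -> f = y.
Proof.
move=> E; apply/eqP; rewrite -subr_eq0; apply/eqP/hnorm_eq0/eqP.
have := frame_op_below (f - y); rewrite frame_opB E subrr hnorm0.
have a2 : 0 < al ^+ 2 by case: eal => al0 _; rewrite exprn_gt0.
by rewrite pmulr_rle0 // => h; rewrite eq_le h hnorm_ge0.
Qed.

(** Richardson iteration [u + lam (y - S u)]: each step applies [1 - lam S] to the residual. Since
    [ip (S r) r >= al^2 |r|^2] and [|S r| <= B^2 |r|], the squared norm of the residual shrinks by
    the factor [1 - 2 lam al^2 + lam^2 B^4]. *)
Lemma frame_op_surj y : al <= B -> exists f, S f = y.
Proof.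
move=> alB; have [al0 _] := eal.
have B0 : 0 < B by apply: lt_le_trans al0 alB.
(* This value minimizes [1 - 2 lam al^2 + lam^2 B^4]; the minimum is [1 - (al / B)^4]. *)
pose lam : R := al ^+ 2 / B ^+ 4.
have lam0 : 0 < lam by rewrite divr_gt0 // exprn_gt0.
pose t : R := (al / B) ^+ 4.
have t0 : 0 < t by rewrite exprn_gt0 // divr_gt0.
have t1 : t <= 1.
  by rewrite exprn_ile1 // ?divr_ge0 ?(ltW al0) ?(ltW B0) // ler_pdivrMr // mul1r.
pose q : R := Num.sqrt (1 - t).
have q2 : q ^+ 2 = 1 - t by rewrite sqr_sqrtr // subr_ge0.
have q0 : 0 <= q by exact: sqrtr_ge0.
have q1 : q < 1 by rewrite -(ltr_sqr) ?nnegrE // q2 expr1n; lra.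
have contr r : hnorm (r - lam%:C%C *: S r) <= q * hnorm r.
  rewrite -ler_sqr ?nnegrE ?mulr_ge0 ?hnorm_ge0 // exprMn q2.
  have [p E le] := frame_op_pos r.
  have lamR : ((lam%:C%C)^*)%R = lam%:C%C by apply/CrealP/complex_realP; exists lam.
  have : ip (r - lam%:C%C *: S r) (r - lam%:C%C *: S r) =
    (hnorm r ^+ 2 - 2 * lam * p + lam ^+ 2 * hnorm (S r) ^+ 2)%:C%C.
    rewrite ipBl !ipBr !ipZl !ipZr lamR -(ip_frame_op r r) E !(ip_hnorm ip_norm).
    by rewrite -!(rmorphM, rmorphB); congr (_%:C)%C; ring.
  rewrite (ip_hnorm ip_norm) => /complexI ->.
  have lamB : lam ^+ 2 * (B ^+ 2) ^+ 2 = lam * al ^+ 2.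
    by rewrite /lam; field; rewrite gt_eqF.
  have tE : t = lam * al ^+ 2 by rewrite /t /lam; field; rewrite gt_eqF.
  have h1 : hnorm (S r) ^+ 2 <= (B ^+ 2) ^+ 2 * hnorm r ^+ 2.
    rewrite -exprMn; apply: lerXn2r; rewrite ?nnegrE ?mulr_ge0 ?hnorm_ge0 ?exprn_ge0 ?(ltW B0) //.
    exact: hnorm_frame_op.
  have h2 := ler_wpM2l (sqr_ge0 lam) h1.
  rewrite (mulrA (lam ^+ 2) (B ^+ 2 ^+ 2)) lamB -tE in h2.
  have h3 := ler_wpM2l (ltW lam0) le; rewrite (mulrA lam (al ^+ 2)) -tE in h3.
  by rewrite -mulrA; lra.
pose u := fix u k := if k is k'.+1 then u k' + lam%:C%C *: (y - S (u k')) else 0.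
have rk k : hnorm (y - S (u k)) <= hnorm y * q ^+ k.
  elim: k => [|k IH].
    have -> : S (u 0%N) = 0 by rewrite -[u 0%N](subrr 0) frame_opB subrr.
    by rewrite subr0 expr0 mulr1.
  have -> : y - S (u k.+1) = (y - S (u k)) - lam%:C%C *: S (y - S (u k)).
    by rewrite /= [u k + _]addrC frame_op_lin opprD addrAC addrA.
  apply: le_trans (contr _) _; rewrite exprS mulrCA.
  by apply: ler_wpM2l.
have [l [ul _]] : exists l : H, u @ \oo --> l /\
    forall n, hnorm (l - u n) <= lam * hnorm y * q ^+ n / (1 - q).
  apply: geometric_cvg; [by rewrite mulr_ge0 ?(ltW lam0) ?hnorm_ge0|by rewrite q0 q1|].
  move=> n; rewrite /= addrAC subrr add0r hnormZ cmod_real ger0_norm ?(ltW lam0) //.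
  by rewrite -mulrA; apply: ler_wpM2l (rk n); exact: ltW.
exists l; apply: (@hlim_unique _ _ (fun k => S (u k))).
  apply/hcvgP => ep ep0; move/hcvgP: ul => ul.
  have B2 : 0 < B ^+ 2 by rewrite exprn_gt0.
  have [N uN] := ul _ (divr_gt0 ep0 B2); exists N => n Nn.
  rewrite -frame_opB; apply: le_lt_trans (hnorm_frame_op _) _.
  by have := uN n Nn; rewrite ltr_pdivlMr // mulrC.
apply/hcvgP => ep ep0.
have qn : (fun n => hnorm y * q ^+ n) @ \oo --> (0 : R).
  rewrite -(mulr0 (hnorm y)); apply: cvgMr; apply: cvg_expr; by rewrite ger0_norm.
move/cvgrPdist_lt: qn => /(_ ep ep0)[N _ qN]; exists N => n Nn.
rewrite hnormBC; apply: le_lt_trans (rk n) _.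
by apply: le_lt_trans (qN n Nn); rewrite sub0r normrN; exact: ler_norm.
Qed.

Hypothesis alB : al <= B.

Let Sinv := pinv setT S.

Lemma frame_opK f : Sinv (S f) = f.
Proof. by apply: pinvKV; rewrite ?inE // => ? ? _ _; exact: frame_op_inj. Qed.

Lemma frame_opKV y : S (Sinv y) = y.
Proof.
by apply: pinvK; rewrite inE; have [f <-] := frame_op_surj y alB; exists f.
Qed.

Lemma frame_inv_lin a f y : Sinv (a *: f + y) = a *: Sinv f + Sinv y.
Proof. by apply: frame_op_inj; rewrite frame_op_lin !frame_opKV. Qed.

Lemma hnorm_frame_inv f : hnorm (Sinv f) <= al ^- 2 * hnorm f.
Proof.
have al2 : 0 < al ^+ 2 by case: eal => al0 _; rewrite exprn_gt0.
by rewrite mulrC ler_pdivlMr // mulrC -{2}(frame_opKV f); exact: frame_op_below.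
Qed.

(** Self-adjointness moves the inverse from [e n] to [f], so that dual coefficients reduce to
    coefficients with respect to [e]. *)
Lemma analysis_dual f :
  analysis ip (canonical_dual ip e) f = analysis ip e (Sinv f).
Proof.
apply/funext => n; rewrite /analysis -{1}(frame_opKV f) ip_frame_op.
by rewrite frame_opKV.
Qed.

Lemma synthesis_analysis_dual f :
  synthesis e (analysis ip (canonical_dual ip e) f) = f.
Proof. by rewrite analysis_dual; exact: frame_opKV. Qed.

End Bessel.

End Frames.

(** * Riesz bases *)

Section RieszBases.
Variables (R : realType) (H : completeNormedModType R[i]).
Variable ip : {dot H for Num.conj}.
Hypothesis ip_norm : hilbert_norm ip.
Implicit Types (x y z f : H) (a : R[i]) (c d : nat -> R[i]).

Lemma ccvg_le (u : nat -> R[i]^o) (l : R[i]^o) (B : R) : u @ \oo --> l ->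
  (forall n, cmod (u n) <= B) -> cmod l <= B.
Proof.
move=> /ccvgP ul uB; apply/ler_addgt0Pr => ep ep0.
have [N uN] := ul _ ep0.
have -> : l = u N + - (u N - l) by rewrite opprB addrC subrK.
apply: le_trans (cmodD _ _) _; apply: lerD (uB N) _.
by rewrite normcN; apply/ltW/uN.
Qed.

(** * Orthonormal bases and their images under bounded bijections *)

Section Orthonormal.
Variable u : nat -> H.
Hypothesis u_on : orthonormal_basis ip u.

Lemma ip_sum_onb c N j :
  ip (\sum_(k < N) c k *: u k) (u j) = if (j < N)%N then c j else 0.
Proof.
have [on _] := u_on; rewrite ip_suml.
under eq_bigr do rewrite ipZl on.
have [jN|Nj] := ltnP j N.
  rewrite (bigD1 (Ordinal jN)) //= eqxx mulr1 big1 ?addr0 // => k kj.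
  have -> : (nat_of_ord k == j) = false.
    by apply/negbTE; apply: contra_neq kj => E; exact/val_inj.
  by rewrite mulr0.
rewrite big1 // => k _; have -> : (nat_of_ord k == j) = false.
  by have := ltn_ord k; lia.
by rewrite mulr0.
Qed.

Lemma hnorm_sum_onb c N :
  hnorm (\sum_(k < N) c k *: u k) ^+ 2 = \sum_(k < N) cmod (c k) ^+ 2.
Proof.
apply: (@complexI R); rewrite -(ip_hnorm ip_norm).
set s := \sum_(k < N) c k *: u k.
have -> : ip s s = \sum_(k < N) c k * (ip s (u k))^*%R.
  by rewrite {1}/s ip_suml; apply: eq_bigr => k _; rewrite ipZl (ipC ip (u k)).
rewrite rmorph_sum; apply: eq_bigr => k _.
by rewrite ip_sum_onb ltn_ord -normCK normr_cmod rmorphXn.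
Qed.

(** The adjoint of [A] is bypassed by testing with [s = sum c_k u_k]: the square sum of the
    coefficients equals both [ip (A s) f] and the squared norm of [s]. *)
Lemma bessel_image (A : {linear H -> H}) (C : R) : 0 <= C ->
    (forall x, hnorm (A x) <= C * hnorm x) ->
  bessel ip (fun n => A (u n)) C.
Proof.
move=> C0 AC; split=> // f; split=> [|N]; first by rewrite mulr_ge0 ?hnorm_ge0.
set c := fun n => ip f (A (u n)).
pose s := \sum_(k < N) c k *: u k.
pose P := \sum_(k < N) cmod (c k) ^+ 2.
have P0 : 0 <= P by apply: sumr_ge0 => k _; exact: sqr_ge0.
have sP : hnorm s ^+ 2 = P by exact: hnorm_sum_onb.
have : P <= hnorm f * (C * hnorm s).
  apply: le_trans (ler_wpM2l (hnorm_ge0 f) (AC s)).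
  have -> : P = cmod (ip (A s) f).
    rewrite -(ger0_norm P0) -cmod_real /s linear_sum ip_suml rmorph_sum.
    congr cmod; apply: eq_bigr => k _.
    by rewrite linearZ ipZl /= (ipC ip (A _)) -/(c k) -normCK normr_cmod rmorphXn.
  by rewrite cmod_ipC; exact: cauchy_schwarz.
rewrite -/P -sP => h.
have [->|s0] := eqVneq (hnorm s) 0; first by rewrite expr2 mul0r sqr_ge0.
have s1 : 0 < hnorm s by rewrite lt_neqAle eq_sym s0 hnorm_ge0.
apply: lerXn2r; rewrite ?nnegrE ?mulr_ge0 ?hnorm_ge0 //.
rewrite -(ler_pM2r s1) -expr2.
by rewrite (_ : C * hnorm f * hnorm s = hnorm f * (C * hnorm s)) //; ring.
Qed.

Lemma bessel_onb : bessel ip u 1.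
Proof. by apply: (@bessel_image idfun 1) => // x; rewrite mul1r. Qed.

Lemma synthesis_onb f : synthesis u (analysis ip u f) = f.
Proof.
have [_ /(_ f) uf] := u_on.
exact: hlim_unique (synthesis_cvg ip_norm bessel_onb (l2_analysis bessel_onb f)) uf.
Qed.

Lemma analysis_synthesis_onb c : l2 c -> analysis ip u (synthesis u c) = c.
Proof.
move=> cl; apply/funext => j.
apply: (clim_unique (ip_synthesis ip_norm (y := u j) bessel_onb cl)).
apply/ccvgP => ep ep0; exists j.+1 => n jn.
have -> : series (fun n => c n * ip (u n) (u j)) n = c j.
  rewrite series_sumE.
  transitivity (ip (\sum_(k < n) c k *: u k) (u j)).
    by rewrite ip_suml; apply: eq_bigr => k _; rewrite ipZl.
  by rewrite ip_sum_onb jn.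
by rewrite subrr ComplexField.Normc.normc0.
Qed.

Variables (A : {linear H -> H}) (C : R).
Hypothesis C0 : 0 <= C.
Hypothesis AC : forall x, hnorm (A x) <= C * hnorm x.
Hypothesis Abij : bijective A.

Let g n := A (u n).

Let gB : bessel ip g C. Proof. exact: bessel_image. Qed.

Lemma synthesis_image c : l2 c -> A (synthesis u c) = synthesis g c.
Proof.
move=> cl; apply: hlim_unique (synthesis_cvg ip_norm gB cl).
have /hcvgP uc := synthesis_cvg ip_norm bessel_onb cl.
apply/hcvgP => ep ep0.
have C1 : 0 < C + 1 by rewrite ltr_wpDl.
have [N uN] := uc _ (divr_gt0 ep0 C1); exists N => n Nn.
have -> : series (fun n => c n *: g n) n = A (series (fun n => c n *: u n) n).
  by rewrite !series_sumE linear_sum; apply: eq_bigr => k _; rewrite linearZ.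
rewrite -linearB; apply: le_lt_trans (AC _) _.
have := uN n Nn; rewrite ltr_pdivlMr // mulrC; apply: le_lt_trans.
by apply: ler_wpM2r; rewrite ?hnorm_ge0 // lerDl.
Qed.

(** In effect [|A^* y| <= D]: expand [z] in the orthonormal basis and apply Cauchy-Schwarz to the
    two coefficient sequences. *)
Lemma cmod_ip_image z y D : l2le (fun n => cmod (ip y (g n))) D ->
  cmod (ip (A z) y) <= hnorm z * D.
Proof.
move=> yD; rewrite -{1}(synthesis_onb z) synthesis_image; last exact: l2_analysis bessel_onb _.
have zl : l2 (analysis ip u z) by exact: l2_analysis bessel_onb _.
apply: ccvg_le (ip_synthesis ip_norm (y := y) gB zl) _ => n.
rewrite series_sumE; apply: le_trans (cmod_sum _ _) _.
have zz : l2le (fun n => cmod (ip z (u n))) (hnorm z).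
  by have [_ /(_ z)] := bessel_onb; rewrite mul1r.
apply: le_trans (l2le_mul_sum n zz yD).
by apply: ler_sum => i _; rewrite ComplexField.Normc.normcM (cmod_ipC ip y).
Qed.

(* The functionals ip _ y, for y with square sum of ip y (g n) at most 1, are
   pointwise bounded on the range of A, hence uniformly bounded: the gliding
   hump argument of the Banach-Steinhaus theorem. *)
Lemma lower_bound_image : exists al, lower_bound ip g al.
Proof.
suff [K K0 gK] : exists2 K : R, 0 < K & forall y D,
    l2le (fun n => cmod (ip y (g n))) D -> hnorm y <= K * D.
  exists K^-1; split=> [|f D fD]; first by rewrite invr_gt0.
  by rewrite mulrC ler_pdivrMr // mulrC; exact: gK.
apply: contrapT => /forall2NP noK.
(* If no constant works, then every [K] has a unit vector whose coefficients have norm at most some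
   [D < 1 / K]. *)
have bad (K : R) : 0 < K -> exists vD : H * R, [/\ hnorm vD.1 = 1,
    l2le (fun n => cmod (ip vD.1 (g n))) vD.2 & K * vD.2 < 1].
  move=> K0; have [//|/existsNP[y /existsNP[D /not_implyP[yD /negP]]]] := noK K.
  rewrite -ltNge => KD; have [D0 _] := yD.
  have y0 : 0 < hnorm y by apply: le_lt_trans KD; rewrite mulr_ge0 // ltW.
  have cy : cmod ((hnorm y)^-1)%:C%C = (hnorm y)^-1.
    by rewrite cmod_real ger0_norm // invr_ge0 ltW.
  exists ((((hnorm y)^-1)%:C)%C *: y, (hnorm y)^-1 * D); split=> /=.
  - by rewrite hnormZ cy mulVf // gt_eqF.
  - apply: l2le_mono (l2leZ (_ : 0 <= (hnorm y)^-1) yD); last by rewrite invr_ge0 ltW.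
    by move=> n; rewrite ipZl ComplexField.Normc.normcM cy ger0_norm // mulr_ge0 ?invr_ge0 ?cmod_ge0 ?ltW.
  by rewrite mulrCA mulrC ltr_pdivrMr // mul1r.
(* The factor [3^(n+1)] matches the size of the n-th step; the factor [n+1] outgrows the norm of a
   preimage of the limit. *)
have K3 n : 0 < n.+1%:R * 3 ^+ n.+1 :> R by rewrite mulr_gt0 // exprn_gt0.
have [vD vDP] := choice (fun n => bad _ (K3 n)).
pose v n := (vD n).1; pose D n := (vD n).2.
pose t n : R := 3^-1 ^+ n.+1.
have t0 n : 0 < t n by rewrite exprn_gt0 // invr_gt0.
(* The pairings of [x + t v] and [x - t v] with [v] differ by [2 t], so one of them has modulus at
   least [t]. *)
have hump x n : exists x', hnorm (x' - x) <= t n /\ t n <= cmod (ip x' (v n)).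
  have [v1 _ _] := vDP n; rewrite -/(v n) in v1.
  have ct : cmod (t n)%:C%C = t n by rewrite cmod_real ger0_norm // ltW.
  have [le|gt] := leP (t n) (cmod (ip (x + (t n)%:C%C *: v n) (v n))).
    exists (x + (t n)%:C%C *: v n); split=> //.
    by rewrite addrAC subrr add0r hnormZ v1 ct mulr1.
  exists (x - (t n)%:C%C *: v n); split.
    by rewrite addrAC subrr add0r hnormN hnormZ v1 ct mulr1.
  have E : (2 * (t n))%:C%C = ip (x + (t n)%:C%C *: v n) (v n) +
      - ip (x - (t n)%:C%C *: v n) (v n).
    rewrite ipDl ipBl ipZl (ip_hnorm ip_norm) v1 expr1n mulr1 rmorphM /=; ring.
  have := cmodD (ip (x + (t n)%:C%C *: v n) (v n)) (- ip (x - (t n)%:C%C *: v n) (v n)).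
  rewrite -E normcN cmod_real ger0_norm ?mulr_ge0 ?(ltW (t0 n)) //.
  by move: gt; set p := cmod _; set q := cmod _; lra.
have [nxt nxtP] := choice (fun p : H * nat => hump p.1 p.2).
pose w := fix w n := if n is k.+1 then nxt (w k, k) else (0 : H).
have [l [_ wl]] : exists l : H, w @ \oo --> l /\
    forall n, hnorm (l - w n) <= 3^-1 * 3^-1 ^+ n / (1 - 3^-1).
  apply: geometric_cvg; [by rewrite invr_ge0|by apply/andP; split; lra|].
  by move=> n; have [/=] := nxtP (w n, n); rewrite /t exprS.
(* Surjectivity of [A] puts the limit into its range, where [cmod_ip_image] controls the
   pairings. *)
have [Ainv _ AinvK] := Abij.
pose z := Ainv l.
have [n zn] : exists n : nat, 2 * hnorm z < n.+1%:R.
  exists (Num.truncn (2 * hnorm z)); exact: Num.Theory.truncnS_gt.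
have [v1 vg nD] := vDP n; rewrite -/(v n) -/(D n) in v1 vg nD.
have /= [_ tw] := nxtP (w n, n); rewrite -[nxt _]/(w n.+1) in tw.
have lz : cmod (ip l (v n)) <= hnorm z * D n.
  by rewrite -(AinvK l); exact: cmod_ip_image.
(* All later steps together move the sequence by at most [t n / 2], so the pairing of [l] with [v n]
   keeps modulus at least [t n / 2]. *)
have wl' : cmod (ip (w n.+1 - l) (v n)) <= t n / 2.
  apply: le_trans (cauchy_schwarz ip_norm _ _) _; rewrite v1 mulr1 hnormBC.
  apply: le_trans (wl n.+1) _; rewrite -/(t n); have := t0 n.
  rewrite (_ : 3^-1 * t n / (1 - 3^-1) = t n / 2) //; by field.
have := cmodD (ip (w n.+1 - l) (v n)) (ip l (v n)); rewrite -ipDl subrK => h.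
have [D0 _] := vg.
have tD : t n <= 2 * hnorm z * D n by lra.
have t3 : t n * 3 ^+ n.+1 = 1 by rewrite /t -exprMn mulVf ?expr1n.
have p3 : 0 < 3 ^+ n.+1 :> R by rewrite exprn_gt0.
suff : 1 < 1 :> R by rewrite ltxx.
apply: le_lt_trans nD; rewrite -{1}t3 mulrAC ler_wpM2r ?(ltW p3) //.
by apply: le_trans tD _; apply: ler_wpM2r => //; exact: ltW.
Qed.

End Orthonormal.

(** This is the form in which the weighted estimates use [G]: an isomorphism between [H] and l^2,
    with one constant for both directions. *)
Lemma riesz_coordinates (g : nat -> H) : riesz_basis ip g ->
  exists K : R, [/\ 0 < K,
    forall f, l2le (fun n => cmod (analysis ip (canonical_dual ip g) f n)) (K * hnorm f),
    forall f, synthesis g (analysis ip (canonical_dual ip g) f) = f,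
    bessel ip g K &
    forall c, l2 c -> analysis ip (canonical_dual ip g) (synthesis g c) = c].
Proof.
move=> [u [A [u_on [C AC] Abij gE]]].
have {}gE : g = (fun n => A (u n)) by apply/funext.
have AC' x : hnorm (A x) <= `|C| * hnorm x.
  apply: le_trans (AC x) _; apply: ler_wpM2r (ler_norm _); exact: hnorm_ge0.
have [al gal] := lower_bound_image u_on (normr_ge0 C) AC' Abij.
have gB' := bessel_image u_on (normr_ge0 C) AC'.
rewrite -gE in gal gB'.
pose B := Num.max `|C| al.
have weak (B' : R) : B <= B' -> bessel ip g B'.
  move=> BB; have CB : `|C| <= B' by apply: le_trans BB; rewrite /B le_max lexx.
  have [_ gC] := gB'; split; first exact: le_trans CB.
  by move=> f; apply: l2le_weaken (gC f); rewrite ler_wpM2r ?hnorm_ge0.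
have gB := weak B (lexx B).
have alB : al <= B by rewrite /B le_max lexx orbT.
have [al0 _] := gal.
have B0 : 0 < B by apply: lt_le_trans alB.
(* [B] bounds synthesis, and [B * al^-2] bounds the coordinates, which are the analysis coefficients
   of [S^-1 f]. *)
pose K := B + B * al ^- 2.
have a2 : 0 < B * al ^- 2 by rewrite divr_gt0 // exprn_gt0.
exists K; split.
- by rewrite addr_gt0.
- move=> f; rewrite (analysis_dual ip_norm gB gal alB).
  have [_ gf] := gB; apply: l2le_weaken (gf _).
  apply: (@le_trans _ _ (B * (al ^- 2 * hnorm f))).
    apply: ler_wpM2l; first exact: ltW.
    exact: (hnorm_frame_inv ip_norm gB gal alB).
  by rewrite mulrA ler_wpM2r ?hnorm_ge0 // lerDr ltW.
- by move=> f; exact: (synthesis_analysis_dual ip_norm gB gal alB).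
- by apply: weak; rewrite lerDl ltW.
move=> c cl.
apply/funext => n.
rewrite [LHS]ipC.
set d := canonical_dual ip g n.
(* Biorthogonality: the coefficients of [d] against [g] synthesize to [g n = A (u n)], and
   injectivity of [A] transports this back to the orthonormal basis. *)
have dE : analysis ip g d = fun k => (k == n)%:R.
  have dl : l2 (analysis ip g d) by exact: l2_analysis gB _.
  have E : synthesis u (analysis ip g d) = u n.
    apply: (bij_inj Abij); rewrite (synthesis_image u_on (normr_ge0 C) AC' dl) -gE.
    transitivity (g n); last by rewrite gE.
    exact: (frame_opKV ip_norm gB gal alB).
  rewrite -(analysis_synthesis_onb u_on dl) E; apply/funext => k.
  by rewrite /analysis; case: u_on => -> _; rewrite eq_sym.
have dg k : ip (g k) d = (k == n)%:R.
  rewrite ipC -[ip d _]/(analysis ip g d k) dE; exact: rmorph_nat.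
rewrite -ipC; apply: (clim_unique (ip_synthesis ip_norm (y := d) gB cl)).
apply/ccvgP => ep ep0; exists n.+1 => N nN.
have -> : series (fun n => c n * ip (g n) d) N = c n.
  rewrite series_sumE (bigD1 (Ordinal nN)) //= dg eqxx mulr1 big1 ?addr0 // => k kn.
  rewrite dg; have -> : (nat_of_ord k == n) = false.
    by apply/negbTE; apply: contra_neq kn => E; exact/val_inj.
  by rewrite mulr0.
by rewrite subrr ComplexField.Normc.normc0.
Qed.

End RieszBases.

(** * Weighted estimates *)

Section WeightedEstimates.
Variable R : realType.
Local Notation decay d := (((1 + (d)%:R) ^+ 2)^-1).

Lemma distC m n : dist m n = dist n m. Proof. by rewrite /dist addnC. Qed.

Lemma dist_triangle m n k : (dist m n <= dist m k + dist k n)%N.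
Proof. by rewrite /dist; lia. Qed.

(** The source weight sits in the bound on [c], a target weight inside [q]; thus both
    [q m n = w m * k m n] and the commutator [q m n = (w m - w n) * k m n] are covered. *)
Lemma kernel_bound (q : nat -> nat -> R[i]) (c y : nat -> R[i]) (w : nat -> R)
    (F : nat -> nat -> R) (M W : R) : 0 <= M -> (forall n, 0 <= w n) ->
    (forall m n, 0 <= F m n <= M * decay (dist m n)) ->
    (forall m n, cmod (q m n) <= F m n * w n) ->
    (forall m, series (fun n => c n * q m n : R[i]^o) @ \oo --> (y m : R[i]^o)) ->
  l2le (fun n => w n * cmod (c n)) W -> l2le (fun m => cmod (y m)) (4 * M * W).
Proof.
move=> M0 w0 FM qF cy cW.
apply: (@l2le_lim _ (fun N m => cmod (series (fun n => c n * q m n) N))).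
  move=> m; apply/cvgrPdist_le => ep ep0; move/ccvgP: (cy m) => /(_ ep ep0)[N yN].
  exists N => // n Nn /=; have h := yN n Nn.
  set s := series _ n in h *; rewrite ler_norml.
  have h1 := cmodD (s - y m) (y m); rewrite subrK in h1.
  have h2 := cmodD (- (s - y m)) s; rewrite opprB subrK -opprB normcN in h2.
  by apply/andP; split; lra.
move=> N; have [FB _] := schur_dist N M0 FM cW.
apply: l2le_mono FB => m; rewrite ger0_norm ?cmod_ge0 // series_sumE.
apply: le_trans (cmod_sum _ _) _; apply: ler_sum => n _.
rewrite ger0_norm ?mulr_ge0 ?cmod_ge0 // ComplexField.Normc.normcM mulrC mulrA.
by rewrite ler_wpM2r ?cmod_ge0.
Qed.

(** Submultiplicative moduli tending to 1 with [t]. The last clause is the rate of convergence, up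
    to a factor [v 1 d] that the localization absorbs. *)
Definition admissible (v : R -> nat -> R) :=
  [/\ forall t d, 0 < t -> 1 <= v t d,
      forall t, v t 0%N = 1,
      forall t a b, 0 < t -> (a <= b)%N -> v t a <= v t b,
      forall t a b, 0 < t -> v t (a + b)%N <= v t a * v t b
    & forall t d, 0 < t <= 1 -> v t d - 1 <= t * v 1 d].

Definition mild (v : nat -> R) (w : nat -> R) :=
  exists C, forall m n, w m <= C * v (dist m n) * w n.

(* The new weight is the sup-convolution m |-> sup_n w n / v |m - n|. *)
Lemma mild_regularize v (w : nat -> R) : (forall n, 0 < w n) ->
    (forall d, 1 <= v d) -> v 0%N = 1 ->
    (forall a b, (a <= b)%N -> v a <= v b) ->
    (forall a b, v (a + b)%N <= v a * v b) -> mild v w ->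
  exists w' C, [/\ 0 < C, forall n, w n <= w' n <= C * w n
                 & forall m n, w' m <= v (dist m n) * w' n].
Proof.
move=> w0 v1 v0 vmono vM [C wC].
have vp d : 0 < v d by apply: lt_le_trans (v1 d).
have C0 : 0 < C.
  have := wC 0%N 0%N; rewrite /dist v0 mulr1.
  by rewrite -{1}(mul1r (w 0%N)) ler_pM2r //; apply: lt_le_trans.
pose X m := [set w n / v (dist m n) | n in [set: nat]].
have Xb m : ubound (X m) (C * w m).
  by move=> _ [n _ <-]; rewrite ler_pdivrMr // distC mulrAC; exact: wC.
have Xs m : has_sup (X m).
  by split; [exists (w 0%N / v (dist m 0)), 0%N | exists (C * w m); exact: Xb].
exists (fun m => sup (X m)), C; split=> // [n|m n].
  apply/andP; split; last exact: ge_sup (Xs n).1 (Xb n).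
  apply: (sup_upper_bound (Xs n)); exists n => //.
  by rewrite /dist subnn v0 divr1.
apply: ge_sup (Xs m).1 _ => _ [k _ <-].
(* The triangle inequality passes to [v] by monotonicity and submultiplicativity; hence each
   competitor in the supremum at [m] is at most [v (dist m n)] times the one at [n] with the same
   [k]. *)
have h : v (dist n k) <= v (dist m n) * v (dist m k).
  apply: le_trans (vmono _ _ (dist_triangle n k m)) _.
  by rewrite (distC m n) (distC m k); exact: vM.
apply: (@le_trans _ _ (v (dist m n) * (w k / v (dist n k)))); last first.
  by rewrite ler_wpM2l ?(ltW (vp _)) //; apply: (sup_upper_bound (Xs n)); exists k.
rewrite ler_pdivrMr // mulrA mulrAC ler_pdivlMr //.
have := ler_wpM2l (ltW (w0 k)) h; lra.
Qed.

Variables (H : completeNormedModType R[i]) (ip : {dot H for Num.conj}).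
Hypothesis ip_norm : hilbert_norm ip.
Variables (g e : nat -> H) (K al B M : R).

Local Notation coord f := (analysis ip (canonical_dual ip g) f).
Local Notation S := (frame_op ip e).

Hypothesis K0 : 0 < K.
Hypothesis coordK : forall f, l2le (fun n => cmod (coord f n)) (K * hnorm f).
Hypothesis synthesis_coord : forall f, synthesis g (coord f) = f.
Hypothesis gK : bessel ip g K.
Hypothesis coord_synthesis : forall c, l2 c -> coord (synthesis g c) = c.

Hypothesis eB : bessel ip e B.
Hypothesis eal : lower_bound ip e al.

Variable v : R -> nat -> R.
Hypothesis v_adm : admissible v.
Hypothesis M0 : 0 <= M.
Hypothesis loc : forall m n,
  loc_coef ip e g m n * v 1 (dist m n) <= M * decay (dist m n).

Let D := loc_coef ip e g.

Lemma loc_coef_ge0 m n : 0 <= D m n.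
Proof. by rewrite /D /loc_coef le_max cmod_ge0. Qed.

Let D0 := loc_coef_ge0.

Lemma cmod_ip_g_e m n : cmod (ip (g n) (e m)) <= D m n.
Proof. by rewrite cmod_ipC /D /loc_coef le_max lexx. Qed.

Lemma cmod_ip_e_dual m n : cmod (ip (e m) (canonical_dual ip g n)) <= D m n.
Proof. by rewrite /D /loc_coef le_max lexx orbT. Qed.

Lemma analysis_coord f m :
  series (fun n => coord f n * ip (g n) (e m) : R[i]^o) @ \oo -->
  (ip f (e m) : R[i]^o).
Proof.
rewrite -{2}(synthesis_coord f); apply: (ip_synthesis ip_norm gK).
by exists (K * hnorm f).
Qed.

Lemma coord_synthesis_e a n : l2 a ->
  series (fun m => a m * ip (e m) (canonical_dual ip g n) : R[i]^o) @ \oo -->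
  (coord (synthesis e a) n : R[i]^o).
Proof. exact: (ip_synthesis ip_norm eB). Qed.

Lemma ccvg_lin (a b : R[i]) (p q u : nat -> R[i]^o) (x y l : R[i]^o) :
    p @ \oo --> x -> q @ \oo --> y ->
    (forall n, u n = a * p n + b * q n :> R[i]) -> l = a * x + b * y :> R[i] ->
  u @ \oo --> l.
Proof.
move=> /ccvgP px /ccvgP qy uE lE; apply/ccvgP => ep ep0.
have c0 : 0 < cmod a + cmod b + 1 by rewrite ltr_wpDl // addr_ge0 // cmod_ge0.
have [N1 p1] := px _ (divr_gt0 ep0 c0); have [N2 q2] := qy _ (divr_gt0 ep0 c0).
exists (maxn N1 N2) => n; rewrite geq_max => /andP[n1 n2].
have -> : u n - l = a * (p n - x) + b * (q n - y) :> R[i] by rewrite uE lE; ring.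
apply: le_lt_trans (cmodD _ _) _; rewrite !ComplexField.Normc.normcM.
have := p1 n n1; have := q2 n n2; rewrite !ltr_pdivlMr //.
have := cmod_ge0 a; have := cmod_ge0 b; have := cmod_ge0 (p n - x).
have := cmod_ge0 (q n - y).
move: (cmod a) (cmod b) (cmod (p n - x)) (cmod (q n - y)) => A B' P Q' Q0 P0 B0 A0 hQ hP.
have [E|E] := leP P Q'.
  have := ler_wpM2l A0 E; nra.
have := ler_wpM2l B0 (ltW E); nra.
Qed.

Lemma cvg_series_lin (a b : R[i]) (c : nat -> R[i]) (q p : nat -> R[i]) (x y : R[i]) :
    series (fun n => c n * q n : R[i]^o) @ \oo --> (x : R[i]^o) ->
    series (fun n => c n * p n : R[i]^o) @ \oo --> (y : R[i]^o) ->
  series (fun n => c n * (a * q n + b * p n) : R[i]^o) @ \oo --> (a * x + b * y : R[i]^o).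
Proof.
move=> hx hy.
apply: (ccvg_lin (a := a) (b := b) hx hy) => // n.
rewrite !series_sumE !mulr_sumr -big_split /=.
by apply: eq_bigr => k _; ring.
Qed.

(** * Boundedness of the analysis and synthesis matrices on weighted spaces *)

Section Bounded.
Variable w : nat -> R.
Hypothesis w0 : forall n, 0 < w n.
Hypothesis wv : mild (v 1) w.

Let wv' : exists C, 0 < C /\ forall m n, w m <= C * v 1 (dist m n) * w n.
Proof.
have [C wC] := wv; exists C; split=> //.
have [_ v0 _ _ _] := v_adm.
have := wC 0%N 0%N; rewrite /dist v0 mulr1.
by rewrite -{1}(mul1r (w 0%N)) ler_pM2r //; apply: lt_le_trans.
Qed.

(** The alternative covers the analysis matrix and the synthesis matrix, whose indices are
    transposed; the decay depends on the distance only. *)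
Lemma kernel_weight_bound : exists C, 0 < C /\
  forall (k : nat -> nat -> R[i]) (c b : nat -> R[i]) (V : R),
    (forall m n, cmod (k m n) <= D m n) \/ (forall m n, cmod (k m n) <= D n m) ->
    (forall m, series (fun n => c n * k m n : R[i]^o) @ \oo --> (b m : R[i]^o)) ->
    l2le (fun n => w n * cmod (c n)) V ->
    l2le (fun m => w m * cmod (b m)) (C * V).
Proof.
have [C [C0 wC]] := wv'; have [v1 _ _ _ _] := v_adm.
exists (4 * (C * M) + 1); split.
  by rewrite ltr_pwDr // !mulr_ge0 // ltW.
move=> k c b V kD cb cV.
have vp d : 0 < v 1 d by apply: lt_le_trans (v1 _ _ _).
apply: (@l2le_weaken _ _ (4 * (C * M) * V)).
  by case: cV => V0 _; rewrite ler_wpM2r // lerDl.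
apply: (@l2le_mono _ _ (fun m => cmod ((w m)%:C%C * b m))).
  move=> m; rewrite ger0_norm ?mulr_ge0 ?cmod_ge0 ?(ltW (w0 m)) //.
  by rewrite ComplexField.Normc.normcM cmod_real ger0_norm // ltW.
have cvg m : series (fun n => c n * ((w m)%:C%C * k m n) : R[i]^o) @ \oo -->
    ((w m)%:C%C * b m : R[i]^o).
  have := @cvg_series_lin (w m)%:C%C 0 _ _ _ _ _ (cb m) (cb m).
  by under eq_fun do rewrite mul0r addr0; rewrite mul0r addr0.
have fin (P : nat -> nat -> R) : (forall m n, 0 <= P m n) ->
    (forall m n, P m n * v 1 (dist m n) <= M * decay (dist m n)) ->
    (forall m n, cmod (k m n) <= P m n) ->
    l2le (fun m => cmod ((w m)%:C%C * b m)) (4 * (C * M) * V).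
  move=> P0 Pl kP.
  apply: (@kernel_bound (fun m n => (w m)%:C%C * k m n) c (fun m => (w m)%:C%C * b m) w
    (fun m n => C * (P m n * v 1 (dist m n))) _ _ _ _ _ _ cvg cV).
  - by rewrite mulr_ge0 // ltW.
  - by move=> n; rewrite ltW.
  - move=> m n; rewrite !mulr_ge0 ?(ltW C0) ?(ltW (vp _)) //= -mulrA ler_wpM2l ?(ltW C0) //.
  - move=> m n; rewrite ComplexField.Normc.normcM cmod_real ger0_norm ?(ltW (w0 m)) //.
    apply: le_trans (ler_pM (ltW (w0 m)) (cmod_ge0 _) (wC m n) (kP m n)) _.
    by rewrite [leLHS](_ : _ = C * (P m n * v 1 (dist m n)) * w n) //; ring.
case: kD => [kD|kD]; first exact: fin kD.
by apply: (fin (fun m n => D n m)) => // m n; rewrite distC; exact: loc.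
Qed.

End Bounded.

(** [t * Q] bounds the total commutator error: the first summand stems from the synthesis matrix,
    the second from the analysis matrix. *)
Let Q := 4 * K * M * (4 * M * K + B) + 4 * M * B * K.

(** The bound [W] enters only qualitatively: it makes the weighted vector [x] exist, so that the
    error [t * Q * hnorm x] is finite and can be absorbed into [al^2 * hnorm x]. *)
Lemma frame_inv_bounded_weight (w : nat -> R) (t V W : R) (h : H) :
    0 < t <= 1 -> t * Q <= al ^+ 2 / 2 -> (forall n, 0 < w n) ->
    (forall m n, w m <= v t (dist m n) * w n) ->
    l2le (fun n => w n * cmod (coord h n)) W ->
    l2le (fun n => w n * cmod (coord (S h) n)) V ->
  l2le (fun n => w n * cmod (coord h n)) (K * (2 * K / al ^+ 2 * V)).
Proof.
move=> t01 tQ w0 wt hW fV.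
have [t0 t1] := andP t01; have [v1 _ _ _ vt] := v_adm.
have [B0 eB'] := eB; have [al0 _] := eal.
have wC (c : nat -> R[i]) n : cmod ((w n)%:C%C * c n) = w n * cmod (c n).
  by rewrite ComplexField.Normc.normcM cmod_real ger0_norm // ltW.
have hW' : l2 (fun n => (w n)%:C%C * coord h n).
  by exists W; under [X in l2le X]eq_fun do rewrite wC.
(* [x] is [h] with its coordinates multiplied by [w]; the lower bound of [S] on [H] is applied to
   it. *)
pose x := synthesis g (fun n => (w n)%:C%C * coord h n).
have xE : coord x = fun n => (w n)%:C%C * coord h n by exact: coord_synthesis.
have wx : l2le (fun n => w n * cmod (coord h n)) (K * hnorm x).
  by under [X in l2le X]eq_fun do rewrite -wC -[X in cmod X]/((fun n => (w n)%:C%C * coord h n) _) -xE.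
have vp s : 0 < v 1 s by apply: lt_le_trans (v1 _ _ _).
have wd (P : nat -> nat -> R) (k : nat -> nat -> R[i]) m n :
    (forall m n, 0 <= P m n) -> (forall m n, cmod (k m n) <= P m n) ->
    cmod (((w m)%:C%C - (w n)%:C%C) * k m n) <= t * (P m n * v 1 (dist m n)) * w n.
  move=> P0 kP; rewrite ComplexField.Normc.normcM -rmorphB cmod_real.
  (* Upwards this is [wt m n]. Downwards [wt n m] gives [(v_t - 1) * w m], and then [w m <= w n]. *)
  have le : `|w m - w n| <= t * v 1 (dist m n) * w n.
    have h1 := wt m n; have h2 := wt n m; rewrite distC in h2.
    have h3 : 0 <= v t (dist m n) - 1 by rewrite subr_ge0 v1.
    have h4 := ler_wpM2r (ltW (w0 n)) (vt t (dist m n) t01).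
    apply: le_trans h4; rewrite mulrBl mul1r ler_norml; apply/andP; split; last by lra.
    have [wmn|wnm] := leP (w m) (w n); last first.
      have := mulr_ge0 h3 (ltW (w0 n)); lra.
    have := ler_wpM2l h3 wmn; lra.
  apply: le_trans (ler_pM (normr_ge0 _) (cmod_ge0 _) le (kP m n)) _.
  by rewrite [leLHS](_ : _ = t * (P m n * v 1 (dist m n)) * w n) //; ring.
(* [b] is the image of [c] and [b'] that of [w c], so [w b - b'] is the commutator of [w] with the
   matrix [k], applied to [c]. *)
have com (P : nat -> nat -> R) (k : nat -> nat -> R[i]) (c b b' : nat -> R[i]) W1 :
    (forall m n, 0 <= P m n) -> (forall m n, cmod (k m n) <= P m n) ->
    (forall m n, P m n * v 1 (dist m n) <= M * decay (dist m n)) ->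
    (forall m, series (fun n => c n * k m n : R[i]^o) @ \oo --> (b m : R[i]^o)) ->
    (forall m, series (fun n => (w n)%:C%C * c n * k m n : R[i]^o) @ \oo --> (b' m : R[i]^o)) ->
    l2le (fun n => w n * cmod (c n)) W1 ->
    l2le (fun m => cmod ((w m)%:C%C * b m - b' m)) (4 * (t * M) * W1).
  move=> P0 kP Pl cb cb' cW1.
  apply: (@kernel_bound (fun m n => ((w m)%:C%C - (w n)%:C%C) * k m n) c
    (fun m => (w m)%:C%C * b m - b' m) w (fun m n => t * (P m n * v 1 (dist m n))) _ _ _ _ _ _ _ cW1).
  - by rewrite mulr_ge0 // ltW.
  - by move=> n; rewrite ltW.
  - by move=> m n; rewrite !mulr_ge0 ?(ltW t0) ?(ltW (vp _)) //= -mulrA ler_wpM2l ?(ltW t0).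
  - by move=> m n; exact: wd.
  - move=> m.
    apply: (ccvg_lin (a := (w m)%:C%C) (b := -1) (cb m) (cb' m)); last by rewrite mulN1r.
    move=> n; rewrite !series_sumE !mulr_sumr -big_split /=.
    by apply: eq_bigr => j _; ring.
pose a := analysis ip e h; pose a' := analysis ip e x.
have com1 : l2le (fun m => cmod ((w m)%:C%C * a m - a' m)) (4 * (t * M) * (K * hnorm x)).
  apply: (com D (fun m n => ip (g n) (e m)) (coord h)) => //.
  - exact: cmod_ip_g_e.
  - by move=> m; exact: analysis_coord.
  - by move=> m; have := analysis_coord (f := x) (m := m); rewrite xE.
(* The weighted coefficients of [h] differ from the coefficients of [x] by a commutator, so
   [hnorm x] controls them too; this is the input of the second commutator. *)
have wa : l2le (fun m => w m * cmod (a m)) ((4 * (t * M) * K + B) * hnorm x).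
  rewrite mulrDl -mulrA; apply: l2le_mono (l2leD com1 (eB' x)) => m.
  rewrite ger0_norm ?mulr_ge0 ?cmod_ge0 ?(ltW (w0 m)) // -wC.
  by have := cmodD ((w m)%:C%C * a m - a' m) (a' m); rewrite subrK.
have wal : l2 (fun m => (w m)%:C%C * a m).
  by exists ((4 * (t * M) * K + B) * hnorm x); under [X in l2le X]eq_fun do rewrite wC.
pose y := synthesis e (fun m => (w m)%:C%C * a m).
have com2 : l2le (fun n => cmod ((w n)%:C%C * coord (S h) n - coord y n))
    (4 * (t * M) * ((4 * (t * M) * K + B) * hnorm x)).
  apply: (com (fun m n => D n m) (fun n m => ip (e m) (canonical_dual ip g n)) a) => //.
  - by move=> m n; exact: cmod_ip_e_dual.
  - by move=> m n; rewrite distC; exact: loc.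
  - by move=> n; apply: coord_synthesis_e; exact: (l2_analysis eB).
  - by move=> n; exact: coord_synthesis_e.
have fl : l2 (fun n => (w n)%:C%C * coord (S h) n).
  by exists V; under [X in l2le X]eq_fun do rewrite wC.
(* [z] is [S h] with weighted coordinates. Between [z] and [S x] stands [y]: [z - y] carries the
   synthesis commutator, [y - S x] the analysis commutator. *)
pose z := synthesis g (fun n => (w n)%:C%C * coord (S h) n).
have zV : hnorm z <= K * V.
  by apply: (hnorm_synthesis ip_norm gK); under [X in l2le X]eq_fun do rewrite wC.
have zy : hnorm (z - y) <= K * (4 * (t * M) * ((4 * (t * M) * K + B) * hnorm x)).
  rewrite -[z - y]synthesis_coord; apply: (hnorm_synthesis ip_norm gK).
  apply: l2le_mono com2 => n; rewrite ger0_norm ?cmod_ge0 // /analysis ipBl.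
  by rewrite -[ip z _]/(coord z n) coord_synthesis.
have ySx : hnorm (y - S x) <= B * (4 * (t * M) * (K * hnorm x)).
  have a'l : l2 a' by exact: (l2_analysis eB).
  have -> : y - S x = synthesis e (fun m => (w m)%:C%C * a m - a' m).
    rewrite /y /frame_op -/a' addrC -scaleN1r -(synthesis_lin ip_norm eB) //.
    by congr synthesis; apply/funext => m; rewrite mulN1r addrC.
  exact: (hnorm_synthesis ip_norm eB com1).
have Sx := frame_op_below ip_norm eB eal x.
have tri : hnorm (S x) <= hnorm z + hnorm (z - y) + hnorm (y - S x).
  have E : S x = z + - (z - y) + - (y - S x).
    by rewrite !opprB [z + _]addrC subrK addrC subrK.
  have h1 := hnormD (z + - (z - y)) (- (y - S x)); have h2 := hnormD z (- (z - y)).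
  by rewrite !hnormN -E in h1 h2; lra.
have x0 := hnorm_ge0 x.
have main : al ^+ 2 * hnorm x <= K * V + t * Q * hnorm x.
  have : K * (4 * (t * M) * ((4 * (t * M) * K + B) * hnorm x)) <=
      t * (4 * K * M * (4 * M * K + B)) * hnorm x.
    have -> : K * (4 * (t * M) * ((4 * (t * M) * K + B) * hnorm x)) =
       (t * (4 * K * M)) * hnorm x * (4 * M * K * t + B) by ring.
    have -> : t * (4 * K * M * (4 * M * K + B)) * hnorm x =
       (t * (4 * K * M)) * hnorm x * (4 * M * K + B) by ring.
    apply: ler_wpM2l; first by rewrite !mulr_ge0 // ltW.
    by rewrite lerD2r ler_piMr // !mulr_ge0 // ltW.
  have -> : t * Q * hnorm x = t * (4 * K * M * (4 * M * K + B)) * hnorm x +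
     B * (4 * (t * M) * (K * hnorm x)) by rewrite /Q; ring.
  lra.
apply: l2le_weaken wx; apply: ler_wpM2l; first exact: ltW.
have a2 : 0 < al ^+ 2 by rewrite exprn_gt0.
have tQx := ler_wpM2r x0 tQ.
rewrite mulrAC ler_pdivlMr // mulrC; lra.
Qed.

Lemma frame_inv_weight (w : nat -> R) : (forall n, 0 < w n) ->
    (forall t, 0 < t <= 1 -> mild (v t) w) ->
  exists C, 0 < C /\ forall h V,
    l2le (fun n => w n * cmod (coord (S h) n)) V ->
    l2le (fun n => w n * cmod (coord h n)) (C * V).
Proof.
move=> w0 wv; have [v1 v0 vmono vM _] := v_adm; have [al0 _] := eal.
have a2 : 0 < al ^+ 2 by rewrite exprn_gt0.
have [B0 _] := eB.
have Q0 : 0 <= Q.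
  by rewrite /Q addr_ge0 // ?mulr_ge0 ?addr_ge0 // ?mulr_ge0 // ltW.
(* [Q + 1] keeps the denominator positive; the cap 1 is the range of the last clause of
   [admissible]. *)
pose t := Num.min 1 (al ^+ 2 / 2 / (Q + 1)).
have Q1 : 0 < Q + 1 by rewrite ltr_wpDl.
have t01 : 0 < t <= 1.
  by rewrite /t lt_min ltr01 ge_min lexx andbT /= !divr_gt0.
have [t0 _] := andP t01.
have tQ : t * Q <= al ^+ 2 / 2.
  apply: (@le_trans _ _ (t * (Q + 1))); first by rewrite ler_wpM2l ?(ltW t0) // lerDl.
  by rewrite -ler_pdivlMr // /t ge_min lexx orbT.
have vt1 d : 1 <= v t d by exact: v1.
have vtp d : 0 < v t d by apply: lt_le_trans (vt1 d).
have [w' [C [C0 ww' w'v]]] := mild_regularize w0 vt1 (v0 t)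
  (fun a b => vmono t a b t0) (fun a b => vM t a b t0) (wv t t01).
have w'0 n : 0 < w' n by case/andP: (ww' n) => h _; apply: lt_le_trans h.
exists (K * (2 * K / al ^+ 2 * C)); split.
  by rewrite !mulr_gt0 // invr_gt0.
move=> h V fV.
have fV' : l2le (fun n => w' n * cmod (coord (S h) n)) (C * V).
  apply: l2le_mono (l2leZ (ltW C0) fV) => n.
  rewrite ger0_norm ?mulr_ge0 ?cmod_ge0 ?(ltW (w'0 n)) // mulrA ler_wpM2r ?cmod_ge0 //.
  by case/andP: (ww' n).
pose wN (N n : nat) := Num.min (w' n) N.+1%:R.
have wN0 N n : 0 < wN N n by rewrite /wN lt_min w'0 ltr0n.
have wNle N n : wN N n <= w' n by rewrite /wN ge_min lexx.
have bd N : l2le (fun n => wN N n * cmod (coord h n)) (K * (2 * K / al ^+ 2 * (C * V))).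
  apply: (@frame_inv_bounded_weight (wN N) t (C * V) (N.+1%:R * (K * hnorm h))) => //.
  - move=> m n; rewrite /wN minr_pMr ?(ltW (vtp _)) //; rewrite le_min !ge_min w'v /=.
    by rewrite ler_peMl ?vt1 ?orbT.
  - apply: l2le_mono (l2leZ (ler0n _ N.+1) (coordK h)) => n.
    rewrite ger0_norm ?mulr_ge0 ?cmod_ge0 ?(ltW (wN0 N n)) // ler_wpM2r ?cmod_ge0 //.
    by rewrite /wN ge_min lexx orbT.
  apply: l2le_mono fV' => n.
  by rewrite ger0_norm ?mulr_ge0 ?cmod_ge0 ?(ltW (wN0 N n)) // ler_wpM2r ?cmod_ge0.
(* At each [n] the truncated weight eventually equals [w' n], so the uniform bound survives. *)
have lim' : l2le (fun n => w' n * cmod (coord h n)) (K * (2 * K / al ^+ 2 * (C * V))).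
  apply: l2le_lim bd => n; apply: cvg_near_cst.
  exists (Num.truncn (w' n)) => // N /= nN; congr (_ * _); apply/min_idPl.
  apply: ltW; apply: lt_le_trans (Num.Theory.truncnS_gt _) _.
  by rewrite ler_nat ltnS.
rewrite (_ : _ * V = K * (2 * K / al ^+ 2 * (C * V))); last by ring.
apply: l2le_mono lim' => n.
rewrite ger0_norm ?mulr_ge0 ?cmod_ge0 ?(ltW (w0 n)) // ler_wpM2r ?cmod_ge0 //.
by case/andP: (ww' n).
Qed.

End WeightedEstimates.

(** * Admissible moduli *)

Section LocalizationWeights.
Variable R : realType.
Local Notation decay d := (((1 + (d)%:R) ^+ 2)^-1).

(** On [0, 1] one has [u <= u^be]; take [u = x / (x + y)] and [u = y / (x + y)], and add. *)
Lemma powR_subadd (be x y : R) : 0 < be <= 1 -> 0 <= x -> 0 <= y ->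
  (x + y) `^ be <= x `^ be + y `^ be.
Proof.
move=> /andP[b0 b1] x0 y0.
have [s0|s0] := eqVneq (x + y) 0.
  by rewrite s0 powR0 ?gt_eqF // addr_ge0 ?powR_ge0.
have sp : 0 < x + y by rewrite lt_neqAle eq_sym s0 addr_ge0.
have part z : 0 <= z -> z <= x + y -> (x + y) `^ be * (z / (x + y)) <= z `^ be.
  move=> z0 zs; have q0 : 0 <= z / (x + y) by rewrite divr_ge0 // ltW.
  rewrite -{2}(divfK s0 z) powRM ?(ltW sp) // [leRHS]mulrC ler_wpM2l ?powR_ge0 //.
  have [->|zn] := eqVneq (z / (x + y)) 0; first exact: powR_ge0.
  by apply: ger1_powR => //; rewrite lt_neqAle eq_sym zn q0 ler_pdivrMr // mul1r.
have hx := part x x0; have hy := part y y0.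
rewrite lerDl in hx; rewrite lerDr in hy.
have := lerD (hx y0) (hy x0).
by rewrite -mulrDr -mulrDl divff // mulr1.
Qed.

(** By convexity exp lies below its chord between 0 and [x], which gives
    [exp (t x) <= t exp x + 1 - t]. *)
Lemma expR_chord (t x : R) : 0 < t <= 1 -> expR (t * x) - 1 <= t * expR x.
Proof.
move=> /andP[t0 t1].
have := convex_expR (Itv01 (ltW t0) t1) (x : R^o) (0 : R^o).
rewrite !convRE /= mulr0 addr0 expR0 mulr1 => h.
by rewrite lerBlDr; apply: le_trans h _; rewrite lerD2l gerBl ltW.
Qed.

Section Subexponential.
Variables (be a : R).
Hypothesis be01 : 0 < be <= 1.
Hypothesis a0 : 0 < a.

Let be0 : 0 < be. Proof. by case/andP: be01. Qed.

Definition exp_modulus (t : R) (d : nat) : R := expR (t * (a * d%:R `^ be)).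

Lemma admissible_exp : admissible exp_modulus.
Proof.
have p0 d : 0 <= a * d%:R `^ be by rewrite mulr_ge0 ?powR_ge0 ?ltW.
rewrite /exp_modulus; split.
- by move=> t d t0; rewrite -[leLHS]expR0 ler_expR mulr_ge0 // ltW.
- by move=> t; rewrite powR0 ?gt_eqF // !mulr0 expR0.
- move=> t m n t0 mn; rewrite ler_expR !ler_wpM2l ?(ltW t0) ?(ltW a0) //.
  by apply: (ge0_ler_powR (ltW be0)); rewrite ?nnegrE ?ler0n ?ler_nat.
- move=> t m n t0; rewrite -expRD ler_expR -mulrDr ler_wpM2l ?(ltW t0) //.
  by rewrite -mulrDr ler_wpM2l ?(ltW a0) // natrD powR_subadd.
- by move=> t d t01; rewrite mul1r; exact: expR_chord.
Qed.

(** Raise [c (1 + y) <= 1 + (a / j) y <= exp (a y / j)] to a power [j] with [j * be >= 2], where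
    [y = d^be] and [(1 + d)^be <= 1 + y]. *)
Lemma exp_modulus_growth : exists M : R, 0 < M /\
  forall d : nat, expR (- (a * d%:R `^ be)) <= M * decay d.
Proof.
pose j := (Num.truncn (2 / be)).+1.
have jb : 2 <= j%:R * be.
  by rewrite -ler_pdivrMr //; apply/ltW/Num.Theory.truncnS_gt.
pose c : R := Num.min 1 (a / j%:R).
have c0 : 0 < c by rewrite /c lt_min ltr01 divr_gt0.
exists (c ^- j); split=> [|d]; first by rewrite invr_gt0 exprn_gt0.
rewrite expRN -invfM lef_pV2 ?posrE ?expR_gt0 ?mulr_gt0 ?exprn_gt0 ?ltr_pwDl //.
set y := d%:R `^ be; have y0 : 0 <= y by exact: powR_ge0.
have -> : a * y = j%:R * (a / j%:R * y) by rewrite mulrA mulrCA divff ?mulr1 ?pnatr_eq0.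
rewrite expRM_natl.
have h1 : c * (1 + y) <= expR (a / j%:R * y).
  apply: le_trans (expR_ge1Dx _); rewrite mulrDr mulr1; apply: lerD.
    by rewrite /c ge_min lexx.
  by rewrite ler_wpM2r // /c ge_min lexx orbT.
apply: (@le_trans _ _ ((c * (1 + y)) ^+ j)); last first.
  by apply: lerXn2r h1; rewrite nnegrE ?expR_ge0 // mulr_ge0 ?addr_ge0 ?(ltW c0).
rewrite exprMn ler_wpM2l ?exprn_ge0 ?(ltW c0) //.
have h2 : (1 + d%:R) `^ be <= 1 + y.
  by have := powR_subadd be01 ler01 (ler0n R d); rewrite powR1.
apply: (@le_trans _ _ (((1 + d%:R) `^ be) ^+ j)); last first.
  by apply: lerXn2r h2; rewrite nnegrE ?powR_ge0 // addr_ge0.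
have d1 : 1 <= 1 + d%:R :> R by rewrite lerDl.
rewrite -powR_mulrn ?powR_ge0 // -powRrM -[X in X <= _]powR_mulrn ?addr_ge0 //.
by apply: ler_powR => //; rewrite mulrC.
Qed.

Lemma subexp_weight_mild (mu : R -> R) (bk : R) (t : R) : 0 < bk < be ->
    (forall x, 0 < mu x) -> subexp_weight bk mu -> 0 < t ->
  mild (exp_modulus t) (fun n => mu n.+1%:R).
Proof.
move=> /andP[bk0 bkb] mu0 [C [ga [C0 ga0 muC]]] t0.
have ta0 : 0 < t * a by rewrite mulr_gt0.
have bb : be - bk != 0 by rewrite gt_eqF // subr_gt0.
(* The exponents [ga d^bk] and [t a d^be] meet at [X0]: up to it the constant dominates, beyond it
   the modulus. *)
pose X0 := (ga / (t * a)) `^ (be - bk)^-1.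
have X0E : X0 `^ (be - bk) = ga / (t * a).
  by rewrite -powRrM mulVf // powRr1 // divr_ge0 // ltW.
exists (C * expR (ga * X0 `^ bk)) => m n.
have := muC (m.+1%:R - n.+1%:R) n.+1%:R; rewrite subrK => h.
apply: le_trans h _; rewrite ler_wpM2r ?(ltW (mu0 _)) // -mulrA ler_wpM2l ?(ltW C0) //.
rewrite -expRD ler_expR mulrA.
have -> : `|m.+1%:R - n.+1%:R| = (dist m n)%:R :> R.
  by rewrite distE /idist -!natr1 opprD addrACA subrr addr0.
set d : R := (dist m n)%:R; have d0 : 0 <= d by exact: ler0n.
have p0 : 0 <= t * a * d `^ be by rewrite mulr_ge0 ?powR_ge0 ?ltW.
have q0 : 0 <= ga * X0 `^ bk by rewrite mulr_ge0 ?powR_ge0 ?ltW.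
have [dX|Xd] := leP d X0.
  apply: (@le_trans _ _ (ga * X0 `^ bk)); last by rewrite lerDl.
  by rewrite ler_wpM2l ?(ltW ga0) // ge0_ler_powR ?nnegrE ?powR_ge0 ?(ltW bk0).
apply: (@le_trans _ _ (t * a * d `^ be)); last by rewrite lerDr.
have dp : 0 < d by apply: le_lt_trans Xd; exact: powR_ge0.
have -> : d `^ be = d `^ bk * d `^ (be - bk).
  by rewrite -powRD ?subrKC // (gt_eqF dp) implybT.
rewrite mulrCA mulrC ler_wpM2l ?powR_ge0 //.
rewrite -ler_pdivrMl // mulrC -X0E.
by rewrite ge0_ler_powR ?nnegrE ?powR_ge0 ?subr_ge0 ?(ltW bkb) // ltW.
Qed.

End Subexponential.

Section Polynomial.
Variable k : nat.

Definition poly_modulus (t : R) (d : nat) : R := (1 + t * d%:R) ^+ k.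

Lemma admissible_poly : admissible poly_modulus.
Proof.
rewrite /poly_modulus; split.
- by move=> t d t0; rewrite exprn_ege1 // lerDl mulr_ge0 // ltW.
- by move=> t; rewrite mulr0 addr0 expr1n.
- move=> t m n t0 mn; apply: lerXn2r; rewrite ?nnegrE ?addr_ge0 ?mulr_ge0 ?(ltW t0) //.
  by rewrite lerD2l ler_wpM2l ?ler_nat // ltW.
- move=> t m n t0; rewrite -exprMn; apply: lerXn2r.
  + by rewrite nnegrE addr_ge0 ?mulr_ge0 ?(ltW t0).
  + by rewrite nnegrE mulr_ge0 ?addr_ge0 ?mulr_ge0 ?(ltW t0).
  rewrite natrD; have := mulr_ge0 (mulr_ge0 (ltW t0) (ler0n R m)) (mulr_ge0 (ltW t0) (ler0n R n)).
  by move: (m%:R) (n%:R) => x y; nra.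
move=> t d /andP[t0 t1]; rewrite mul1r; set x : R := d%:R.
have x0 : 0 <= x by exact: ler0n.
(* Convexity of [t |-> (1 + t x)^k] on [0, 1], proved by induction on [k]. *)
suff : (1 + t * x) ^+ k <= 1 + t * ((1 + x) ^+ k - 1) by lra.
elim: k => [|j IH]; first by rewrite !expr0 subrr mulr0 addr0.
rewrite !exprS; have P1 : 1 <= (1 + x) ^+ j by rewrite exprn_ege1 // lerDl.
have h0 : 0 <= 1 + t * x by rewrite addr_ge0 // mulr_ge0 // ltW.
apply: le_trans (ler_wpM2l h0 IH) _.
move: ((1 + x) ^+ j) P1 => P P1.
have h1 : 0 <= t * x * ((1 - t) * (P - 1)) by rewrite !mulr_ge0 ?subr_ge0 // ltW.
rewrite -subr_ge0 [leRHS](_ : _ = t * x * ((1 - t) * (P - 1))) //; ring.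
Qed.

Lemma moderate_mild (mu : R -> R) (t : R) : (forall x, 0 < mu x) ->
    moderate k%:R mu -> 0 < t <= 1 -> mild (poly_modulus t) (fun n => mu n.+1%:R).
Proof.
move=> mu0 [C [C0 muC]] /andP[t0 t1].
(* The constant comes from [t (1 + d) <= 1 + t d], valid for [t <= 1]. *)
exists (C * t ^- k) => m n.
have := muC (m.+1%:R - n.+1%:R) n.+1%:R; rewrite subrK => h.
apply: le_trans h _; rewrite ler_wpM2r ?(ltW (mu0 _)) // -mulrA ler_wpM2l ?(ltW C0) //.
have -> : `|m.+1%:R - n.+1%:R| = (dist m n)%:R :> R.
  by rewrite distE /idist -!natr1 opprD addrACA subrr addr0.
rewrite powR_mulrn ?addr_ge0 // ler_pdivlMl ?exprn_gt0 // -exprMn; apply: lerXn2r.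
- by rewrite nnegrE mulr_ge0 ?addr_ge0 // ltW.
- by rewrite nnegrE addr_ge0 ?mulr_ge0 // ltW.
by rewrite mulrDr mulr1 lerD2r.
Qed.

End Polynomial.

Variables (H : completeNormedModType R[i]) (ip : {dot H for Num.conj}).
Variables (g e : nat -> H) (mu : R -> R).
Hypothesis mu0 : forall x, 0 < mu x.

(** The common consequence of assumptions (A) and (B). The modulus may depend on the weight, so each
    space of the scale is treated separately. *)
Definition controlled := exists (v : R -> nat -> R) (M : R),
  [/\ admissible v, 0 <= M,
      forall m n, loc_coef ip e g m n * v 1 (dist m n) <= M * decay (dist m n)
    & forall t, 0 < t <= 1 -> mild (v t) (fun n => mu n.+1%:R)].

Lemma controlled_subexp (be bk : R) : 0 < be <= 1 -> 0 < bk < be ->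
    subexp_weight bk mu -> subexp_localized ip e g be -> controlled.
Proof.
move=> be01 bkb muk [ga [C [ga0 C0 De]]].
(* Half of the decay rate goes into the modulus, the other half into the quadratic decay for the
   Schur test. *)
have a0 : 0 < ga / 2 by rewrite divr_gt0.
have [M [M0 MP]] := exp_modulus_growth be01 a0.
exists (exp_modulus be (ga / 2)), (C * M); split.
- exact: admissible_exp.
- by rewrite mulr_ge0 // ltW.
- move=> m n; rewrite /exp_modulus mul1r.
  apply: le_trans (ler_wpM2r (expR_ge0 _) (De m n)) _.
  rewrite -distE -!mulrA ler_wpM2l ?(ltW C0) // -expRD.
  apply: le_trans (MP (dist m n)); rewrite ler_expR; lra.
by move=> t /andP[t0 _]; exact: (subexp_weight_mild a0 bkb mu0 muk t0).
Qed.

(** Exponential localization is the case [be = 1], which the exponential moduli therefore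
    include. *)
Lemma controlled_exp (bk : R) : 0 < bk < 1 ->
    subexp_weight bk mu -> exp_localized ip e g -> controlled.
Proof.
move=> bk1 muk [ga [C [ga0 C0 De]]].
apply: (@controlled_subexp 1 bk) => //; first by rewrite ltr01 lexx.
exists ga, C; split=> // m n; rewrite powRr1 ?normr_ge0 //; exact: De.
Qed.

Lemma controlled_poly (k : nat) : moderate k%:R mu ->
    (forall s : nat, (0 < s)%N -> poly_localized ip e g s%:R) -> controlled.
Proof.
move=> muk De; have [C [C0 DC]] := De k.+2 isT.
exists (poly_modulus k), C; split.
- exact: admissible_poly.
- exact: ltW.
- move=> m n; rewrite /poly_modulus mul1r.
  have d0 : 0 < 1 + (dist m n)%:R :> R by rewrite ltr_pwDl.
  apply: le_trans (ler_wpM2r _ (DC m n)) _; first by rewrite exprn_ge0 // ltW.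
  rewrite -distE powRN powR_mulrn ?(ltW d0) // -mulrA ler_wpM2l ?(ltW C0) //.
  by rewrite -addn2 exprD invfM mulrAC mulVf ?mul1r // expf_neq0 // gt_eqF.
by move=> t t01; exact: moderate_mild.
Qed.

End LocalizationWeights.

(** * Fréchet spaces and sequence spaces *)

Section FSpaceTheory.
Variable R : realType.

Definition fsubspace (V : lmodType R[i]) (Y : fspace V) :=
  [/\ fcarrier Y 0,
      forall (a : R[i]) y z, fcarrier Y y -> fcarrier Y z -> fcarrier Y (a *: y + z)
    & forall k y, 0 <= fnorm Y k y].

Section Linear.
Variables (V W : lmodType R[i]) (Y : fspace V).
Hypothesis Ysub : fsubspace Y.

Let Y0 : fcarrier Y 0. Proof. by case: Ysub. Qed.
Let Ylin (a : R[i]) y z : fcarrier Y y -> fcarrier Y z -> fcarrier Y (a *: y + z).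
Proof. by case: Ysub => _ h _; exact: h. Qed.

Definition linear_on (T : V -> W) := forall (a : R[i]) y z,
  fcarrier Y y -> fcarrier Y z -> T (a *: y + z) = a *: T y + T z.

Lemma fsubspaceB y z : fcarrier Y y -> fcarrier Y z -> fcarrier Y (y - z).
Proof. by move=> Yy Yz; rewrite addrC -scaleN1r; exact: Ylin. Qed.

Lemma fsubspace_sum (c : nat -> R[i]) (u : nat -> V) N :
  (forall n, fcarrier Y (u n)) -> fcarrier Y (\sum_(k < N) c k *: u k).
Proof.
move=> Yu; elim: N => [|N IH]; first by rewrite big_ord0; exact: Y0.
by rewrite big_ord_recr /= addrC; exact: Ylin.
Qed.

Variable T : V -> W.
Hypothesis Tlin : linear_on T.

Lemma linear_on0 : T 0 = 0.
Proof.
have := Tlin (-1) Y0 Y0.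
by rewrite !scaleN1r oppr0 addr0 addNr.
Qed.

Lemma linear_onB y z : fcarrier Y y -> fcarrier Y z -> T (y - z) = T y - T z.
Proof.
move=> Yy Yz; rewrite addrC -scaleN1r Tlin //.
by rewrite scaleN1r addrC.
Qed.

Lemma linear_on_sum (c : nat -> R[i]) (u : nat -> V) N :
  (forall n, fcarrier Y (u n)) ->
  T (\sum_(k < N) c k *: u k) = \sum_(k < N) c k *: T (u k).
Proof.
move=> Yu; elim: N => [|N IH]; first by rewrite !big_ord0 linear_on0.
rewrite !big_ord_recr /= addrC Tlin //; last exact: fsubspace_sum.
by rewrite IH addrC.
Qed.

End Linear.

Lemma fbounded_comp (V W Z : lmodType R[i]) (Y1 : fspace V) (Y2 : fspace W)
    (Y3 : fspace Z) (A : V -> W) (B : W -> Z) :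
  fbounded Y1 Y2 A -> fbounded Y2 Y3 B -> fbounded Y1 Y3 (fun y => B (A y)).
Proof.
move=> [A1 A2 A3] [B1 B2 B3]; split.
- by move=> y Yy; exact/B1/A1.
- by move=> a y z Yy Yz; rewrite A2 // B2 //; exact: A1.
move=> k; have [C [C0 AC]] := A3 k; have [D [D0 BD]] := B3 k.
exists (D * C); split=> [|y Yy]; first exact: mulr_gt0.
apply: le_trans (BD _ (A1 _ Yy)) _; rewrite -mulrA ler_wpM2l ?(ltW D0) //.
exact: AC.
Qed.

Lemma fbounded_continuous (V W : lmodType R[i]) (Y : fspace V) (Z : fspace W)
    (A : V -> W) x : fsubspace Y -> fbounded Y Z A -> fcarrier Y x ->
  A @ fnbhs Y x --> fnbhs Z (A x).
Proof.
move=> Ysub [A1 A2 A3] Yx P [N [ep [ep0 NP]]]; have [_ _ Yn] := Ysub.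
(* A basic neighbourhood involves finitely many norms, so a single constant serves all of them. *)
have [C [C0 AC]] : exists C : R, 0 < C /\ forall k, (k <= N)%N ->
    forall y, fcarrier Y y -> fnorm Z k (A y) <= C * fnorm Y k y.
  elim: N {NP} => [|N [C [C0 IH]]].
    by have [C [C0 AC]] := A3 0%N; exists C; split=> // k; rewrite leqn0 => /eqP ->.
  have [D [D0 AD]] := A3 N.+1; exists (C + D); split=> [|k]; first exact: addr_gt0.
  rewrite leq_eqVlt => /orP[/eqP ->|kN] y Yy.
    by apply: le_trans (AD _ Yy) _; rewrite ler_wpM2r // lerDr ltW.
  by apply: le_trans (IH k kN y Yy) _; rewrite ler_wpM2r // lerDl ltW.
rewrite /=; exists N, (ep / C); split=> [|y [Yy yk]]; first exact: divr_gt0.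
apply: NP; split=> [|k kN]; first exact: A1.
rewrite -(linear_onB A2) //.
apply: le_lt_trans (AC k kN _ (fsubspaceB Ysub Yy Yx)) _.
by rewrite mulrC -ltr_pdivlMr //; exact: yk.
Qed.

Lemma fcvgI (V : lmodType R[i]) (Y : fspace V) (u : nat -> V) x :
    (forall n, fcarrier Y (u n)) ->
    (forall k (ep : R), 0 < ep -> exists N, forall n, (N <= n)%N ->
      fnorm Y k (u n - x) < ep) ->
  u @ \oo --> fnbhs Y x.
Proof.
move=> Yu ux P [N [ep [ep0 NP]]].
suff [N' uN'] : exists N', forall n, (N' <= n)%N -> forall k, (k <= N)%N ->
    fnorm Y k (u n - x) < ep.
  by exists N' => // n /= Nn; apply: NP; split=> //; exact: uN'.
elim: N {NP} => [|N [N1 IH]].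
  by have [N' uN'] := ux 0%N _ ep0; exists N' => n Nn k; rewrite leqn0 => /eqP ->; exact: uN'.
have [N2 u2] := ux N.+1 _ ep0; exists (maxn N1 N2) => n.
rewrite geq_max => /andP[n1 n2] k; rewrite leq_eqVlt => /orP[/eqP ->|]; first exact: u2.
exact: IH.
Qed.

Lemma fcvg_comp (V : lmodType R[i]) (Y : fspace V) (T : Type) (F : set_system T)
    (u : nat -> V) (A : V -> T) x :
  u @ \oo --> fnbhs Y x -> A @ fnbhs Y x --> F -> (fun n => A (u n)) @ \oo --> F.
Proof. by move=> ux Ax P FP; have := ux _ (Ax P FP). Qed.

Lemma fdual_comp (V W : lmodType R[i]) (Y : fspace V) (Z : fspace W)
    (A : V -> W) (phi : W -> R[i]^o) : fsubspace Y -> fbounded Y Z A ->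
  fdual Z phi -> fdual Y (fun y => phi (A y)).
Proof.
move=> Ysub Ab [phi1 phi2]; have [A1 A2 _] := Ab; split.
  by move=> a y z Yy Yz; rewrite A2 // phi1 //; exact: A1.
move=> x Yx P xP; have := fbounded_continuous Ysub Ab Yx.
move=> /(_ (phi @^-1` P)); apply.
exact: (phi2 _ (A1 _ Yx) P xP).
Qed.

(** For functionals given by [limn], whose values outside the carrier carry no meaning. *)
Lemma fdual_ext (V : lmodType R[i]) (Y : fspace V) (phi psi : V -> R[i]^o) :
    fsubspace Y -> (forall y, fcarrier Y y -> phi y = psi y) ->
  fdual Y phi -> fdual Y psi.
Proof.
move=> [Y0 Ylin _] E [phi1 phi2]; split.
  by move=> a y z Yy Yz; rewrite -!E //; [exact: phi1|exact: Ylin].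
move=> x Yx P; rewrite -E // => xP.
have [N [ep [ep0 NP]]] := phi2 _ Yx P xP.
exists N, ep; split=> // y yN; rewrite /= -E; last by case: yN.
exact: NP.
Qed.

(** The left inverse [T] yields the lower frame bound, by estimating [f = T (A f)]. *)
Lemma frechet_frameI (V : lmodType R[i]) (X : fspace V)
    (Theta : fspace (nat -> R[i])) (A : V -> nat -> R[i]) (T : (nat -> R[i]) -> V) :
    fsubspace X -> fsubspace Theta ->
    (forall n, fdual Theta (fun c => c n : R[i]^o)) ->
    fbounded X Theta A -> fbounded Theta X T ->
    (forall f, fcarrier X f -> T (A f) = f) ->
  frechet_frame X Theta (fun n f => A f n).
Proof.
move=> Xsub Tsub Tn Ab Tb TA; have [A1 A2 A3] := Ab; have [T1 T2 T3] := Tb.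
split=> //.
- by move=> n; exact: fdual_comp Xsub Ab (Tn n).
- move=> k; have [C [C0 AC]] := A3 k; have [D [D0 TD]] := T3 k.
  (* If [X] has no vector of positive norm, nothing relates [D^-1] and [C]; hence the maximum. *)
  exists D^-1, (Num.max D^-1 C); split.
  + by rewrite invr_gt0.
  + by rewrite le_max lexx.
  move=> f Xf; split.
    by rewrite mulrC ler_pdivrMr // mulrC -{1}(TA f Xf); exact/TD/A1.
  apply: le_trans (AC f Xf) _; case: Xsub => _ _ X0.
  by rewrite ler_wpM2r // le_max lexx orbT.
by exists T.
Qed.

End FSpaceTheory.

(** * Weighted sequence spaces and their canonical basis *)

Section SequenceSpaces.
Variables (R : realType) (mu : nat -> R -> R).
Hypothesis mu_gt0 : forall k x, 0 < mu k x.

Local Notation Theta := (ThetaF mu).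

Definition wl2le k (a : nat -> R[i]) V := l2le (fun n => cmod (a n) * mu k n.+1%:R) V.

Definition dlt (n : nat) : nat -> R[i] := fun m => (m == n)%:R.

Lemma ThetaP a : fcarrier Theta a <-> forall k, exists V, wl2le k a V.
Proof.
split; first by move=> h k; exists (ell2_norm (mu k) a); apply: l2le_ell2; exact: h.
by move=> h k _; have [V /ell2_l2le[]] := h k.
Qed.

Lemma Theta_norm k a : fcarrier Theta a -> wl2le k a (fnorm Theta k a).
Proof. by move=> h; apply: l2le_ell2; exact: h. Qed.

Lemma Theta_norm_le k a V : wl2le k a V -> fnorm Theta k a <= V.
Proof. by move=> /ell2_l2le[]. Qed.

Lemma wl2le_lin k (z : R[i]) a b V W : wl2le k a V -> wl2le k b W ->
  wl2le k (fun n => z * a n + b n) (cmod z * V + W).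
Proof.
move=> aV bW; apply: l2le_mono (l2leD (l2leZ (cmod_ge0 z) aV) bW) => n.
have m0 := ltW (mu_gt0 k n.+1%:R).
rewrite ger0_norm ?mulr_ge0 ?cmod_ge0 // mulrA -mulrDl ler_wpM2r //.
by rewrite -ComplexField.Normc.normcM; exact: cmodD.
Qed.

Lemma Theta_subspace : fsubspace Theta.
Proof.
split.
- apply/ThetaP => k; exists 0; split=> // N; rewrite big1 ?expr2 ?mulr0 // => i _.
  by rewrite -[(0 : nat -> R[i]) i]/(0 : R[i]) ComplexField.Normc.normc0 mul0r expr2 mul0r.
- move=> a y z /ThetaP yT /ThetaP zT; apply/ThetaP => k.
  by have [V yV] := yT k; have [W zW] := zT k; eexists; exact: wl2le_lin yV zW.
by move=> k y; exact: sqrtr_ge0.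
Qed.

Lemma Theta_dlt n : fcarrier Theta (dlt n).
Proof.
apply/ThetaP => k; exists (mu k n.+1%:R); split=> [|N]; first exact: ltW.
have [nN|Nn] := ltnP n N.
  rewrite (bigD1 (Ordinal nN)) //= /dlt eqxx ComplexField.Normc.normc1 mul1r big1 ?addr0 // => i.
  by move=> /eqP ni; rewrite (_ : (i == n :> nat) = false) ?ComplexField.Normc.normc0 ?mul0r ?expr2 ?mul0r //;
     apply/eqP => E; apply: ni; exact/val_inj.
rewrite big1 ?sqr_ge0 // => i _; rewrite /dlt (_ : (i == n :> nat) = false).
  by rewrite ComplexField.Normc.normc0 mul0r expr2 mul0r.
by have := ltn_ord i; lia.
Qed.

Lemma Theta_coord n : (forall x, mu 0%N x = 1) -> fdual Theta (fun c => c n : R[i]^o).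
Proof.
move=> mu1; split=> // x Tx P; rewrite -nbhs_ballE => -[ep ep0 xP].
have er : ep = (complex.Re ep)%:C%C by rewrite RRe_real // gtr0_real.
have e0 : 0 < complex.Re ep by rewrite -ltcR -er.
exists 0%N, (complex.Re ep); split=> // y [Ty /(_ 0%N isT) yx] /=.
apply: xP; rewrite /= -ball_normE /= distrC er normr_cmod ltcR.
apply: le_lt_trans yx.
have := l2le_pt n (Theta_norm 0%N (fsubspaceB Theta_subspace Ty Tx)).
by rewrite mu1 mulr1 ger0_norm ?cmod_ge0.
Qed.

(** A rearranged partial sum restricts [c] to a finite index set; once this set contains all indices
    below [M], the error is part of a tail. *)
Lemma Theta_series c (s : nat -> nat) : bijective s -> fcarrier Theta c ->
  (fun N => \sum_(k < N) c (s k) *: dlt (s k)) @ \oo --> fnbhs Theta c.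
Proof.
move=> [r rs sr] Tc.
have E N m : (\sum_(k < N) c (s k) *: dlt (s k)) m = if (r m < N)%N then c m else 0.
  elim: N => [|N IH]; first by rewrite big_ord0.
  rewrite big_ord_recr /=.
  transitivity ((\sum_(k < N) c (s k) *: dlt (s k)) m + c (s N) * dlt (s N) m : R[i]).
    by [].
  rewrite IH /dlt ltnS.
  have [->|mN] := eqVneq m (s N); first by rewrite rs ltnn leqnn mulr1 add0r.
  rewrite mulr0 addr0 [in RHS]leq_eqVlt (_ : (r m == N) = false) //.
  by apply/negbTE; apply: contra_neq mN => <-; rewrite sr.
apply: fcvgI => [N|k ep ep0].
  apply: (fsubspace_sum Theta_subspace (fun k => c (s k)) N (u := fun k => dlt (s k))).
  by move=> n; exact: Theta_dlt.
have ep2 : 0 < ep / 2 by rewrite divr_gt0.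
have [M cM] := l2le_tail (Theta_norm k Tc) ep2.
(* After [N] terms the permutation has listed every index below [M]. *)
pose N := \max_(m < M) (r m).+1.
exists N => n Nn; apply: (@le_lt_trans _ _ (ep / 2)); last by lra.
apply: Theta_norm_le; apply: l2le_mono cM => m.
rewrite -[X in cmod X]/((\sum_(k < n) c (s k) *: dlt (s k)) m - c m) E.
have m0 := ltW (mu_gt0 k m.+1%:R).
rewrite ger0_norm ?mulr_ge0 ?cmod_ge0 //; case: ifPn => [_|nr].
  rewrite subrr ComplexField.Normc.normc0 mul0r; case: ifP => // _.
  by rewrite mulr_ge0 ?cmod_ge0.
rewrite ifF; first by rewrite sub0r normcN.
apply: contraNF nr => mM; apply: leq_trans Nn.
exact: (leq_bigmax (F := fun m : 'I_M => (r m).+1) (Ordinal mM)).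
Qed.

End SequenceSpaces.

(** * Localized frames *)

Section LocalizedFrames.
Variables (R : realType) (H : completeNormedModType R[i]).
Variable ip : {dot H for Num.conj}.
Hypothesis ip_norm : hilbert_norm ip.
Variables (g e : nat -> H) (mu : nat -> R -> R).
Hypothesis g_riesz : riesz_basis ip g.
Hypothesis e_frame : frame ip e.
Hypothesis mu_gt0 : forall k x, 0 < mu k x.
Hypothesis mu0 : forall x, mu 0%N x = 1.
Hypothesis ctrl : forall k, controlled ip g e (mu k).

Local Notation Theta := (ThetaF mu).
Local Notation X := (XF mu ip g).
Local Notation coord := (analysis ip (canonical_dual ip g)).
Local Notation S := (frame_op ip e).
Local Notation Si := (pinv setT (frame_op ip e)).
Local Notation et := (canonical_dual ip e).

Lemma coord_lin a f h : coord (a *: f + h) = fun n => a * coord f n + coord h n.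
Proof. exact: analysis_lin. Qed.

Lemma XF_P f : fcarrier X f <-> fcarrier Theta (coord f).
Proof. by []. Qed.

Lemma XF_subspace : fsubspace X.
Proof.
have [T0 Tlin _] := Theta_subspace mu_gt0; split.
- apply/XF_P; rewrite (_ : coord 0 = 0) //.
  by apply/funext => n; rewrite /analysis ip0l.
- by move=> a y z Xy Xz; apply/XF_P; rewrite coord_lin; exact: Tlin.
by move=> k y; exact: sqrtr_ge0.
Qed.

Lemma Theta_l2 c : fcarrier Theta c -> l2 c.
Proof.
move=> /ThetaP /(_ 0%N)[V cV]; exists V; move: cV.
by rewrite /wl2le; under [X in l2le X]eq_fun do rewrite mu0 mulr1.
Qed.

Lemma wl2leC k a V : l2le (fun n => mu k n.+1%:R * cmod (a n)) V <-> wl2le mu k a V.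
Proof. by rewrite /wl2le; under [X in _ <-> l2le X _]eq_fun do rewrite mulrC. Qed.

(** In the last estimate [f] ranges over all of [H], so it proves membership in [X_k] and not only a
    norm bound. *)
Lemma weighted_bounds k : exists C : R, [/\ 0 < C,
  forall f V, wl2le mu k (coord f) V -> wl2le mu k (analysis ip e f) (C * V),
  forall c V, l2 c -> wl2le mu k c V -> wl2le mu k (coord (synthesis e c)) (C * V) &
  forall f V, wl2le mu k (coord (S f)) V -> wl2le mu k (coord f) (C * V)].
Proof.
have [al [B [alB eB eal]]] := frame_bessel_lower e_frame.
have [K [K0 cK sc gK cs]] := riesz_coordinates ip_norm g_riesz.
have [v [M [vadm M0 loc mil]]] := ctrl k.
have w0 n : 0 < mu k n.+1%:R by exact: mu_gt0.
have m1 : mild (v 1) (fun n => mu k n.+1%:R) by apply: mil; rewrite ltr01 lexx.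
have [C1 [C10 bnd]] := kernel_weight_bound vadm M0 loc w0 m1.
have [C2 [C20 inv]] :=
  frame_inv_weight ip_norm K0 cK sc gK cs eB eal vadm M0 loc w0 mil.
have mono (D : R) a V : D <= C1 + C2 -> 0 <= V -> wl2le mu k a (D * V) ->
    wl2le mu k a ((C1 + C2) * V).
  by move=> DC V0; apply: l2le_weaken; rewrite ler_wpM2r.
exists (C1 + C2); split.
- exact: addr_gt0.
- move=> f V fV; have [V0 _] := fV; apply: (mono C1) => //; first by rewrite lerDl ltW.
  apply/wl2leC; apply: (bnd (fun m n => ip (g n) (e m)) (coord f)).
  + by left=> m n; exact: cmod_ip_g_e.
  + by move=> m; exact: (analysis_coord ip_norm cK sc gK).
  + exact/wl2leC.
- move=> c V cl cV; have [V0 _] := cV; apply: (mono C1) => //; first by rewrite lerDl ltW.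
  apply/wl2leC; apply: (bnd (fun n m => ip (e m) (canonical_dual ip g n)) c).
  + by right=> m n; exact: cmod_ip_e_dual.
  + by move=> m; exact: (coord_synthesis_e ip_norm eB cl).
  + exact/wl2leC.
move=> f V fV; have [V0 _] := fV; apply: (mono C2) => //; first by rewrite lerDr ltW.
by apply/wl2leC/inv/wl2leC.
Qed.

Lemma analysis_fbounded : fbounded X Theta (analysis ip e).
Proof.
split.
- move=> f /XF_P /ThetaP fX; apply/ThetaP => k.
  by have [C [_ h _ _]] := weighted_bounds k; have [V /h fV] := fX k; exists (C * V).
- by move=> a f h _ _; exact: analysis_lin.
move=> k; have [C [C0 h _ _]] := weighted_bounds k; exists C; split=> // f Xf.
by apply: Theta_norm_le; apply: h; exact: Theta_norm.
Qed.

Lemma synthesis_fbounded : fbounded Theta X (synthesis e).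
Proof.
have [al [B [alB eB eal]]] := frame_bessel_lower e_frame.
split.
- move=> c Tc; apply/XF_P/ThetaP => k; have /ThetaP /(_ k)[V cV] := Tc.
  have [C [_ _ h _]] := weighted_bounds k; exists (C * V); apply: h => //.
  exact: Theta_l2.
- by move=> a c d Tc Td; apply: (synthesis_lin ip_norm eB); exact: Theta_l2.
move=> k; have [C [C0 _ h _]] := weighted_bounds k; exists C; split=> // c Tc.
by apply: Theta_norm_le; apply: h; [exact: Theta_l2|exact: Theta_norm].
Qed.

Lemma frame_op_KV f : S (Si f) = f.
Proof.
have [al [B [alB eB eal]]] := frame_bessel_lower e_frame.
exact: (frame_opKV ip_norm eB eal alB).
Qed.

Lemma frame_op_K f : Si (S f) = f.
Proof.
have [al [B [alB eB eal]]] := frame_bessel_lower e_frame.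
exact: (frame_opK ip_norm eB eal).
Qed.

(** Gives surjectivity of [S] on [X]: the preimage exists in [H], and membership is reflected. *)
Lemma frame_op_reflect f : fcarrier X (S f) -> fcarrier X f.
Proof.
move=> /XF_P /ThetaP Sf; apply/XF_P/ThetaP => k; have [V fV] := Sf k.
by have [C [_ _ _ h]] := weighted_bounds k; exists (C * V); exact: h.
Qed.

Lemma frame_inv_fbounded : fbounded X X Si.
Proof.
have [al [B [alB eB eal]]] := frame_bessel_lower e_frame.
have SiX f : fcarrier X f -> fcarrier X (Si f).
  by move=> Xf; apply: frame_op_reflect; rewrite frame_op_KV.
split=> //.
- by move=> a f h _ _; exact: (frame_inv_lin ip_norm eB eal alB).
move=> k; have [C [C0 _ _ h]] := weighted_bounds k; exists C; split=> // f Xf.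
by apply: Theta_norm_le; apply: h; rewrite frame_op_KV; exact: Theta_norm.
Qed.

Lemma frame_op_fbounded : fbounded X X S.
Proof. exact: fbounded_comp analysis_fbounded synthesis_fbounded. Qed.

Lemma analysis_dualE f : analysis ip et f = analysis ip e (Si f).
Proof.
have [al [B [alB eB eal]]] := frame_bessel_lower e_frame.
exact: (analysis_dual ip_norm eB eal alB).
Qed.

Lemma analysis_dual_fbounded : fbounded X Theta (analysis ip et).
Proof.
rewrite (_ : analysis ip et = fun f => analysis ip e (Si f)); last first.
  by apply/funext => f; exact: analysis_dualE.
exact: fbounded_comp frame_inv_fbounded analysis_fbounded.
Qed.

Lemma synthesis_dlt n : synthesis e (dlt R n) = e n.
Proof.
have [al [B [alB eB eal]]] := frame_bessel_lower e_frame.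
have dl : l2 (dlt R n) by apply: Theta_l2; exact: Theta_dlt.
apply: hlim_unique (synthesis_cvg ip_norm eB dl) _.
apply/hcvgP => ep ep0; exists n.+1 => N nN.
rewrite series_sumE (bigD1 (Ordinal nN)) //= /dlt eqxx scale1r big1 => [|k kn].
  by rewrite addr0 subrr hnorm0.
rewrite (_ : (k == n :> nat) = false) ?scale0r //.
by apply/negbTE; apply: contra_neq kn => E; exact/val_inj.
Qed.

(** Pushes the expansion in canonical vectors forward: the synthesis operator yields series in [e],
    its composite with [S^-1] series in the dual frame. *)
Lemma fbounded_series (A : (nat -> R[i]) -> H) c (s : nat -> nat) :
    fbounded Theta X A -> fcarrier Theta c -> bijective s ->
  series (fun n => c (s n) *: A (dlt R (s n))) @ \oo --> fnbhs X (A c).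
Proof.
move=> Ab Tc sb; have Tsub := Theta_subspace mu_gt0; have [_ Alin _] := Ab.
have := fcvg_comp (Theta_series mu_gt0 sb Tc) (fbounded_continuous Tsub Ab Tc).
rewrite (_ : (fun n => _) = series (fun n => c (s n) *: A (dlt R (s n)))) //.
apply/funext => n; rewrite series_sumE.
rewrite (linear_on_sum Tsub Alin (fun k => c (s k)) n (u := fun k => dlt R (s k))) //.
by move=> k; exact: Theta_dlt.
Qed.

Lemma fdual_series (U : (nat -> R[i]) -> R[i]^o) c : fdual Theta U ->
    fcarrier Theta c ->
  series (fun n => c n * U (dlt R n) : R[i]^o) @ \oo --> U c.
Proof.
move=> [Ulin Uc] Tc; have Tsub := Theta_subspace mu_gt0.
have sb : bijective (@id nat) by exists id.
have := fcvg_comp (Theta_series mu_gt0 sb Tc) (Uc c Tc).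
rewrite (_ : (fun n => _) = series (fun n => c n * U (dlt R n) : R[i]^o)) //.
apply/funext => n; rewrite series_sumE.
by rewrite (linear_on_sum Tsub Ulin c n (u := dlt R)) // => k; exact: Theta_dlt.
Qed.

Lemma frame_expansion f : synthesis e (analysis ip et f) = f.
Proof. by rewrite analysis_dualE; exact: frame_op_KV. Qed.

End LocalizedFrames.

Theorem theorem6p1 (R : realType) (H : completeNormedModType R[i])
    (ip : {dot H for Num.conj}) (ip_norm : hilbert_norm ip)
    (H_sep : separable H)
    (g : nat -> H) (g_riesz : riesz_basis ip g)
    (mu : nat -> R -> R) (mu_weight : forall k, weight (mu k))
    (mu0 : forall x, mu 0%N x = 1)
    (mu_mono : forall k x, mu k x <= mu k.+1 x)
    (e : nat -> H) (e_XF : forall n, fcarrier (XF mu ip g) (e n))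
    (e_frame : frame ip e)
    (e_loc :
      (exists betak : nat -> R,
         [/\ forall k, 0 < betak k < 1,
             forall k, subexp_weight (betak k) (mu k)
           & (exists beta : R, [/\ 0 < beta < 1,
                forall k, betak k < beta & subexp_localized ip e g beta])
             \/ exp_localized ip e g])
      \/
      ((forall k, moderate k%:R (mu k)) /\
       (forall s : nat, (0 < s)%N -> poly_localized ip e g s%:R))) :
  let Theta := ThetaF mu in
  let X := XF mu ip g in
  let et := canonical_dual ip e in
  (forall n, fcarrier X (et n)) /\
  [/\ (* (i) *)
      [/\ fbounded X Theta (analysis ip e),
          forall c, fcarrier Theta c ->
            series (fun n => c n *: e n) @ \oo --> fnbhs X (synthesis e c),
          fbounded Theta X (synthesis e),
          fbounded X X (frame_op ip e) /\
          set_bij (fcarrier X) (fcarrier X) (frame_op ip e)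
        & forall f, fcarrier X f ->
            forall sigma : nat -> nat, bijective sigma ->
            series (fun n => ip f (e (sigma n)) *: e (sigma n)) @ \oo -->
              fnbhs X (frame_op ip e f)],
      (* (ii) *)
      forall f, fcarrier X f ->
        [/\ series (fun n => ip f (et n) *: e n) @ \oo --> fnbhs X f,
            series (fun n => ip f (e n) *: et n) @ \oo --> fnbhs X f,
            fcarrier Theta (analysis ip et f)
          & fcarrier Theta (analysis ip e f)],
      (* (iii) *)
      char_property mu ip g g ->
        char_property mu ip g e /\ char_property mu ip g et,
      (* (iv) *)
      frechet_frame X Theta (fun n f => ip f (e n)) /\
      frechet_frame X Theta (fun n f => ip f (et n))
    & (* (v) *)
      (forall phi, fdual X phi ->
        [/\ forall f, fcarrier X f ->
              series (fun n => ip f (et n) * phi (e n) : R[i]^o) @ \oo --> phi f,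
            forall f, fcarrier X f ->
              series (fun n => ip f (e n) * phi (et n) : R[i]^o) @ \oo --> phi f,
            fdual_seq Theta (fun n => phi (e n))
          & fdual_seq Theta (fun n => phi (et n))]) /\
      (* (vi) *)
      (forall a, fdual_seq Theta a ->
        [/\ forall f, fcarrier X f ->
              cvgn (series (fun n => ip f (e n) * a n : R[i]^o)),
            fdual X (fun f => limn (series (fun n => ip f (e n) * a n : R[i]^o))),
            forall f, fcarrier X f ->
              cvgn (series (fun n => ip f (et n) * a n : R[i]^o))
          & fdual X (fun f => limn (series (fun n => ip f (et n) * a n : R[i]^o)))])].
Proof.
move=> Theta X et.
have mu_gt0 k x : 0 < mu k x by case: (mu_weight k) => _; apply.
have ctrl k : controlled ip g e (mu k).
  case: e_loc => [[betak [bk01 muk [[beta [b01 bkb De]]|De]]]|[muk De]].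
  - have [/andP[b0 b1] /andP[bk0 _]] := (b01, bk01 k).
    apply: (@controlled_subexp _ _ _ _ _ _ (mu_gt0 k) beta (betak k)) => //.
      by rewrite b0 ltW.
    by rewrite bk0 bkb.
  - exact: (controlled_exp (mu_gt0 k) (bk01 k) (muk k) De).
  - exact: (controlled_poly (mu_gt0 k) (muk k) De).
have Xsub : fsubspace X by exact: XF_subspace.
have Tsub : fsubspace Theta by exact: Theta_subspace.
have Ub : fbounded X Theta (analysis ip e) by exact: analysis_fbounded.
have Utb : fbounded X Theta (analysis ip et) by exact: analysis_dual_fbounded.
have Tb : fbounded Theta X (synthesis e) by exact: synthesis_fbounded.
pose Si := pinv setT (frame_op ip e).
have Sib : fbounded X X Si by exact: frame_inv_fbounded.
(* This is the synthesis operator of the dual frame. *)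
have Ttb : fbounded Theta X (fun c => Si (synthesis e c)).
  exact: fbounded_comp Tb Sib.
have Sb : fbounded X X (frame_op ip e) by exact: frame_op_fbounded.
have SK f : Si (frame_op ip e f) = f by exact: frame_op_K.
have SKV f : frame_op ip e (Si f) = f by exact: frame_op_KV.
have Td n : synthesis e (dlt R n) = e n.
  exact: (synthesis_dlt ip_norm (mu := mu)).
have UX f : fcarrier X f -> fcarrier Theta (analysis ip e f) by case: Ub => h _ _; exact: h.
have UtX f : fcarrier X f -> fcarrier Theta (analysis ip et f) by case: Utb => h _ _; exact: h.
have TX c : fcarrier Theta c -> fcarrier X (synthesis e c) by case: Tb => h _ _; exact: h.
have SiX f : fcarrier X f -> fcarrier X (Si f) by case: Sib => h _ _; exact: h.
have idb : bijective (@id nat) by exists id.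
have Te f : synthesis e (analysis ip et f) = f by exact: frame_expansion.
have serT c s : fcarrier Theta c -> bijective s ->
    series (fun n => c (s n) *: e (s n)) @ \oo --> fnbhs X (synthesis e c).
  move=> Tc sb; have := fbounded_series mu_gt0 Tb Tc sb.
  by under [X in series X]eq_fun do rewrite Td.
have serTt c : fcarrier Theta c ->
    series (fun n => c n *: et n) @ \oo --> fnbhs X (Si (synthesis e c)).
  move=> Tc; have := fbounded_series mu_gt0 Ttb Tc idb.
  by under [X in series X]eq_fun do rewrite Td.
have exp1 f : fcarrier X f -> series (fun n => ip f (et n) *: e n) @ \oo --> fnbhs X f.
  by move=> Xf; have := serT _ id (UtX f Xf) idb; rewrite Te.
have exp2 f : fcarrier X f -> series (fun n => ip f (e n) *: et n) @ \oo --> fnbhs X f.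
  by move=> Xf; have := serTt _ (UX f Xf); rewrite -/(frame_op ip e f) SK.
have dualT phi (u : nat -> H) f (c : nat -> R[i]) : fdual X phi ->
    (forall n, fcarrier X (u n)) -> fcarrier X f ->
    series (fun n => c n *: u n) @ \oo --> fnbhs X f ->
    series (fun n => c n * phi (u n) : R[i]^o) @ \oo --> phi f.
  move=> [plin pc] Xu Xf uf; have := fcvg_comp uf (pc f Xf).
  rewrite (_ : (fun n => _) = series (fun n => c n * phi (u n) : R[i]^o)) //.
  by apply/funext => n; rewrite !series_sumE (linear_on_sum Xsub plin).
have Xet n : fcarrier X (et n) by exact: SiX.
have Tcoord n : fdual Theta (fun c => c n : R[i]^o) by exact: Theta_coord.
split=> //; split.
- split=> //.
  + by move=> c Tc; exact: (serT c id).
  + split=> //; split.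
    * by move=> f Xf; case: Sb => h _ _; exact: h.
    * by move=> f h _ _ /(congr1 Si); rewrite !SK.
    * by move=> f Xf; exists (Si f); [exact: SiX|exact: SKV].
  + by move=> f Xf s sb; exact: (serT (analysis ip e f)) (UX f Xf) sb.
- move=> f Xf; split; [exact: exp1|exact: exp2|exact: UtX|exact: UX].
- move=> _; split=> f; split.
  + exact: UX.
  (* Synthesizing the coefficients gives [S f] in [X], hence [f = S^-1 (S f)] lies in [X]. *)
  + by move=> /TX Sf; rewrite -(SK f); exact: SiX.
  + exact: UtX.
  + by move=> /TX; rewrite Te.
- split.
  + by apply: (frechet_frameI Xsub Tsub Tcoord Ub Ttb) => f _; exact: SK.
  + by apply: (frechet_frameI Xsub Tsub Tcoord Utb Tb) => f _; exact: Te.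
split.
  move=> phi pX; split.
  + by move=> f Xf; apply: dualT => //; exact: exp1.
  + by move=> f Xf; apply: dualT => //; exact: exp2.
  (* [phi] after synthesis sends the n-th canonical vector to [phi (e n)]. *)
  + exists (fun c => phi (synthesis e c)); split; first exact: fdual_comp Tsub Tb pX.
    by move=> n; rewrite Td.
  + exists (fun c => phi (Si (synthesis e c))); split; first exact: fdual_comp Tsub Ttb pX.
    by move=> n; rewrite Td.
move=> a [U [UT aE]].
have {}aE : a = fun n => U (dlt R n) by apply/funext => n; rewrite aE.
(* Expanding [A f] in canonical vectors identifies the series with [U (A f)], whose continuity comes
   from [U] and [A]. *)
have lim (A : H -> nat -> R[i]) : fbounded X Theta A -> forall f, fcarrier X f ->
    series (fun n => A f n * a n : R[i]^o) @ \oo --> U (A f).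
  by move=> [AX _ _] f Xf; rewrite aE; exact: (fdual_series mu_gt0 UT (AX f Xf)).
have dual (A : H -> nat -> R[i]) : fbounded X Theta A ->
    fdual X (fun f => limn (series (fun n => A f n * a n : R[i]^o))).
  move=> Ab; apply: (fdual_ext Xsub _ (fdual_comp Xsub Ab UT)) => f Xf.
  by apply/esym/cvg_lim; [exact: norm_hausdorff|exact: lim].
split.
- by move=> f Xf; apply/cvg_ex; exists (U (analysis ip e f)); exact: (lim (analysis ip e)).
- exact: (dual (analysis ip e)).
- by move=> f Xf; apply/cvg_ex; exists (U (analysis ip et f)); exact: (lim (analysis ip et)).
- exact: (dual (analysis ip et)).
Qed.
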